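(* Let $k\in\mathbb{N}$, let $\Omega,F,f,\mathcal{D},\mathcal{E}_k$ be as in the context, and let $Z_0\in\mathbf{X}$ satisfy the stability condition at $t=0$: $$\mathcal{E}_k(0,Z_0)\le \mathcal{E}_k(0,\widetilde Z)+\mathcal{D}(Z_0,\widetilde Z)\quad\text{for all }\widetilde Z\in\mathbf{X}.$$ Then every $Z\in\mathrm{SMM}(\mathbf{Z},\mathcal{E}_k,\mathcal{D};Z_0)$ is an Energetic solution to the rate-independent system $(\mathbf{Z},\mathcal{E}_k,\mathcal{D})$.
   Context: Setting. $\Omega\subset\mathbb{R}^d$ is a bounded Lipschitz domain, $T>0$, $a>0$ a constant, $\mathcal{L}^d$ Lebesgue measure. $\mathbf{Z}$ is the family of Lebesgue measurable subsets of $\Omega$; $P(Z,\Omega)\in[0,\infty]$ is the perimeter of $Z$ in $\Omega$, i.e. $|\mathrm{D}\chi_Z|(\Omega)$; $\mathbf{X}=\{Z\in\mathbf{Z}: P(Z,\Omega)<\infty\}$. All statements about sets are meant up to $\mathcal{L}^d$-null sets. $\mathrm{SBV}(\Omega;\{0,1\})$ denotes the set of characteristic functions of sets in $\mathbf{X}$, and weak$^*$ convergence in it is weak$^*$ convergence in $\mathrm{BV}(\Omega)$. Loading. $F:[0,T]\rightrightarrows\Omega$ is a set-valued map such that: $F(t)$ is open for every $t\in[0,T]$; $F(s)\subset F(t)$ for all $0\le s\le t\le T$; and there is $f\in W^{1,1}(0,T;L^1(\Omega))$ such that for a.a. $t\in(0,T)$ one has $f(t,\cdot)\ge0$ a.e.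 in $\Omega$ and $F(t)=\{x\in\Omega: f(t,x)>0\}$. Dissipation. $\mathcal{D}(Z_1,Z_2)=a\,\mathcal{L}^d(Z_1\setminus Z_2)$ if $Z_2\subset Z_1$, and $\mathcal{D}(Z_1,Z_2)=\infty$ otherwise. Energy. For $k\in\mathbb{N}$, $\mathcal{E}_k(t,Z)=P(Z,\Omega)+\int_\Omega k f(t)\chi_Z\,\mathrm{d}x$; for $Z\in\mathbf{Z}$ and a.a. $t$, its partial time derivative (equal to its left partial time derivative $\partial_t^-\mathcal{E}_k$) is $\partial_t\mathcal{E}_k(t,Z)=\int_\Omega k\,\partial_t f(t,x)\chi_Z(x)\,\mathrm{d}x$. Discrete solutions. For a partition $\Pi_\tau=\{0=\mathsf{t}_\tau^0<\dots<\mathsf{t}_\tau^{N_\tau}=T\}$ with step size $\tau=\max_i(\mathsf{t}_\tau^i-\mathsf{t}_\tau^{i-1})$, a discrete solution starting from $Z_0$ is a family $(Z_\tau^i)_{i=0}^{N_\tau}$ with $Z_\tau^0=Z_0$ and $Z_\tau^i\in\mathrm{Argmin}_{Z\in\mathbf{X}}\{\mathcal{E}_k(\mathsf{t}_\tau^i,Z)+\mathcal{D}(Z_\tau^{i-1},Z)\}$ for $i=1,\dots,N_\tau$. Its left-continuous interpolant is $\overline{Z}_\tau(t)=Z_\tau^i$ for $t\in(\mathsf{t}_\tau^{i-1},\mathsf{t}_\tau^i]$, $\overline{Z}_\tau(0)=Z_0$. Generalized Minimizing Movements. $\mathrm{GMM}(\mathbf{Z},\mathcal{E}_k,\mathcal{D};Z_0)$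 is the set of curves $Z:[0,T]\to\mathbf{X}$ with $Z(0)=Z_0$ for which there are a sequence $\tau_j\downarrow0$, for each $j\in\mathbb{N}$ a partition $\Pi_{\tau_j}$ of $[0,T]$ with step size $\tau_j$ and a discrete solution $(Z_{\tau_j}^i)_{i=0}^{N_{\tau_j}}$ on $\Pi_{\tau_j}$ starting from $Z_0$, with left-continuous interpolant $\overline{Z}_{\tau_j}$, and $C>0$ such that $\mathcal{E}_k(t,\overline{Z}_{\tau_j}(t))\le C$ for all $j\in\mathbb{N}$, $t\in[0,T]$, and $\chi_{\overline{Z}_{\tau_j}(t)}\overset{*}{\rightharpoonup}\chi_{Z(t)}$ in $\mathrm{SBV}(\Omega;\{0,1\})$ as $j\to\infty$ for all $t\in[0,T]$. Stable Minimizing Movements. $\mathrm{SMM}(\mathbf{Z},\mathcal{E}_k,\mathcal{D};Z_0)$ is the set of $Z\in\mathrm{GMM}(\mathbf{Z},\mathcal{E}_k,\mathcal{D};Z_0)$ satisfying, for all $t\in[0,T]$, the stability condition (S): $\mathcal{E}_k(t,Z(t))\le\mathcal{E}_k(t,\widetilde Z)+\mathcal{D}(Z(t),\widetilde Z)$ for all $\widetilde Z\in\mathbf{Z}$. Energetic solution. A curve $Z:[0,T]\to\mathbf{X}$ is an Energetic solution of $(\mathbf{Z},\mathcal{E}_k,\mathcal{D})$ if: $Z(t)\subset Z(s)$ for all $0\le s\le t\le T$; (S) holds for all $t\in[0,T]$; and for all $t\in[0,T]$ $$\mathcal{E}_k(t,Z(t))+\mathcal{D}(Z(0),Z(t))=\mathcal{E}_k(0,Z(0))+\int_0^t\partial_t^-\mathcal{E}_k(s,Z(s))\,\mathrm{d}s.$$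 *)

(* Defs.v *)
From HB Require Import structures.
From mathcomp Require Import all_boot all_order all_algebra.
From mathcomp Require Import all_classical all_reals all_analysis.

Set Implicit Arguments.
Unset Strict Implicit.
Unset Printing Implicit Defensive.
Import Order.TTheory GRing.Theory Num.Theory.
Import numFieldNormedType.Exports.
Local Open Scope classical_set_scope.
Local Open Scope ring_scope.

(* Points of R^n, n >= 1, are row vectors with n = d.+1 coordinates.  The
   library norm on row vectors is the sup norm; the Euclidean one is [enorm]. *)

Section lebesgue_outer_measure.
Context {R : realType} {d : nat}.
Local Notation V := 'rV[R]_d.+1.

Definition box (a b : V) : set V :=
  [set x | forall i, a ord0 i < x ord0 i <= b ord0 i].

Definition box_volume (a b : V) : R :=
  \prod_i Num.max 0 (b ord0 i - a ord0 i).

Definition box_cover (A : set V) : set (nat -> V * V) :=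
  [set c | A `<=` \bigcup_k box (c k).1 (c k).2].

Definition leb_outer (A : set V) : \bar R :=
  ereal_inf [set (\sum_(k <oo) (box_volume (c k).1 (c k).2)%:E)%E
            | c in box_cover A].

Local Open Scope ereal_scope.

Lemma box_volume_ge0 (a b : V) : (0 <= box_volume a b)%R.
Proof. by apply: prodr_ge0 => i _; rewrite le_max lexx. Qed.

Lemma leb_outer_ge0 A : 0 <= leb_outer A.
Proof.
apply: le_ereal_inf_tmp => _ [c _ <-].
by apply: nneseries_ge0 => n _ _; rewrite lee_fin box_volume_ge0.
Qed.

Lemma leb_outer0 : leb_outer set0 = 0.
Proof.
apply/eqP; rewrite eq_le leb_outer_ge0 andbT.
apply: ereal_inf_lbound; exists (fun=> (0%R, 0%R)) => //=.
apply: eseries0 => i _ _; congr EFin.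
by rewrite /box_volume big_ord_recl !mxE subrr maxxx mul0r.
Qed.

Lemma le_leb_outer : {homo leb_outer : A B / A `<=` B >-> A <= B}.
Proof.
move=> A B AB; apply/ereal_inf_le_tmp => _ [c cB <-].
by exists c => //; exact: subset_trans AB cB.
Qed.

Lemma leb_outer_sigma_subadditive : sigma_subadditive leb_outer.
Proof.
move=> A; have [[i ioo]|] := pselect (exists i, leb_outer (A i) = +oo).
  rewrite (eseries_pinfty _ _ ioo) ?leey// => n _.
  by rewrite -ltNye (lt_le_trans _ (leb_outer_ge0 _)).
rewrite -forallNE => Aoo.
suff add2e (e : {posnum R}) :
    leb_outer (\bigcup_n A n) <= \sum_(i <oo) leb_outer (A i) + e%:num%:E.
  by apply/lee_addgt0Pr => _/posnumP[].
rewrite (le_trans _ (epsilon_trick _ _ _))//; last first.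
  by move=> n; exact: leb_outer_ge0.
pose vol (c : V * V) := (box_volume c.1 c.2)%:E.
have vol0 c : 0 <= vol c by rewrite lee_fin box_volume_ge0.
pose P n (B : nat -> V * V) := box_cover (A n) B /\
  \sum_(k <oo) vol (B k) <= leb_outer (A n) + (e%:num / (2 ^ n.+1)%:R)%:E.
have [G PG] : {G : nat -> nat -> V * V & forall n, P n (G n)}.
  apply: (@choice _ _ P) => n; rewrite /P /leb_outer.
  set S := (X in ereal_inf X); move infS : (ereal_inf S) => iS.
  case: iS infS => [r Sr|Soo|Soo].
  - have en1 : (0 < e%:num / (2 ^ n.+1)%:R)%R by [].
    have /(lb_ereal_inf_adherent en1) : ereal_inf S \is a fin_num by rewrite Sr.
    move=> [x [B AnB muBx] xS].
    by exists B; split => //; rewrite muBx -Sr; exact/ltW.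
  - by have := Aoo n; rewrite /leb_outer Soo.
  - by have := leb_outer_ge0 (A n); rewrite /leb_outer Soo.
have volG_ge0 x : 0 <= (vol \o uncurry G) x by exact: vol0.
apply: (@le_trans _ _ (\esum_(i in setT) (vol \o uncurry G) i)).
  rewrite /leb_outer; apply: ereal_inf_lbound => /=.
  have /card_esym/ppcard_eqP[f] := card_nat2.
  exists (uncurry G \o f).
    move=> t [i _ /(PG i).1 [j _ Bijt]]; exists (f^-1%FUN (i, j)) => //=.
    by rewrite invK ?inE.
  rewrite -(esum_pred_image (vol \o uncurry G) _ xpredT) ?[fun=> _]set_true//.
  by rewrite image_eq.
rewrite (_ : esum _ _ = \sum_(i <oo) \sum_(j <oo ) vol (G i j)); last first.
  pose J : nat -> set (nat * nat) := fun i => [set (i, j) | j in setT].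
  rewrite (_ : setT = \bigcup_k J k); last first.
    by rewrite predeqE => -[a b]; split => // _; exists a => //; exists b.
  rewrite esum_bigcupT /=; last 2 first.
    - apply/trivIsetP => i j _ _ ij.
      rewrite predeqE => -[n m] /=; split => //= -[] [_] _ [<-{n} _].
      by move=> [m' _] [] /esym/eqP; rewrite (negbTE ij).
    - by move=> /= [n m]; exact: vol0.
  rewrite -(image_id [set: nat]) -fun_true esum_pred_image//; last first.
    by move=> n _; exact: esum_ge0.
  apply: eq_eseriesr => /= j _.
  rewrite -(esum_pred_image (vol \o uncurry G) (pair j) predT)//=; last first.
    by move=> ? ? _ _; exact: (@can_inj _ _ _ snd).
  by congr esum; rewrite predeqE => -[a b]; split; move=> [i _ <-]; exists i.
apply: lee_lim.
- apply: is_cvg_nneseries => n *.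
  by apply: nneseries_ge0 => m *; exact: (volG_ge0 (n, m)).
- by apply: is_cvg_nneseries => n *; apply: adde_ge0 => //; exact: leb_outer_ge0.
- by near=> n; apply: lee_sum => i _; exact: (PG i).2.
Unshelve. all: by end_near. Qed.

HB.instance Definition _ := isOuterMeasure.Build R V leb_outer
  leb_outer0 leb_outer_ge0 le_leb_outer leb_outer_sigma_subadditive.

End lebesgue_outer_measure.

(* R^(d.+1) with its sigma-algebra of Lebesgue (= Caratheodory) measurable
   sets, and with its Borel sigma-algebra. *)
Notation lebT R d := (caratheodory_type (@leb_outer R d)).
Notation borelT R d := (g_sigma_algebraType (@open 'rV[R]_d.+1)).

Definition leb {R : realType} {d : nat} : set (lebT R d) -> \bar R :=
  @leb_outer R d.
HB.instance Definition _ (R : realType) (d : nat) :=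
  Measure.copy (@leb R d)
    ((@leb_outer R d : outer_measure _ _) : set (lebT R d) -> _).

Section lipschitz_domain.
Context {R : realType} {d : nat}.
Local Notation V := 'rV[R]_d.+1.

Definition dot (u v : V) : R := \sum_i u ord0 i * v ord0 i.
Definition enorm (u : V) : R := Num.sqrt (dot u u).

(* Near each boundary point, Omega lies strictly above a Lipschitz graph over
   the hyperplane orthogonal to a unit vector nu; only the values of g on that
   hyperplane matter. *)
Definition lipschitz_boundary (Omega : set V) : Prop :=
  forall x, closure Omega x -> ~ interior Omega x ->
  exists (U : set V) (nu : V) (g : V -> R),
    [/\ nbhs x U, dot nu nu = 1, [lipschitz g y | y in [set: V]] &
        forall y, U y -> (Omega y <-> g (y - dot y nu *: nu) < dot y nu)].

Definition bounded_lipschitz_domain (Omega : set V) : Prop :=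
  [/\ open Omega, connected Omega, Omega !=set0, bounded_set Omega &
      lipschitz_boundary Omega].

End lipschitz_domain.

Section BV.
Context {R : realType} {d : nat}.
Local Notation V := 'rV[R]_d.+1.
Variable Omega : set V.

Definition partial (i : 'I_d.+1) (phi : V -> R) (x : V) : R :=
  'D_(delta_mx ord0 i) phi x.

Definition Cc1 (phi : V -> R) : Prop :=
  (forall i, (forall x, derivable phi x (delta_mx ord0 i)) /\
             continuous (partial i phi)) /\
  exists K : set V,
    [/\ compact K, K `<=` Omega & forall x, ~ K x -> phi x = 0].

Definition Cc1_field (phi : V -> V) : Prop :=
  forall i, Cc1 (fun x => phi x ord0 i).

Definition divergence (phi : V -> V) (x : V) : R :=
  \sum_i partial i (fun y => phi y ord0 i) x.

Definition L1 (u : V -> R) : Prop :=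
  (@leb R d).-integrable Omega (fun x => (u x)%:E).

Definition L1norm (u : V -> R) : \bar R :=
  (\int[@leb R d]_(x in Omega) `|u x|%:E)%E.

Definition L1dist (u v : V -> R) : \bar R := L1norm (fun x => u x - v x).

Definition grad_variation (u : V -> R) : \bar R :=
  ereal_sup [set (\int[@leb R d]_(x in Omega) (u x * divergence phi x)%:E)%E
            | phi in [set phi : V -> V |
                Cc1_field phi /\ forall x, enorm (phi x) <= 1]].

Definition perimeter (Z : set V) : \bar R := grad_variation \1_Z.

(* The space C_0(Omega): sup-norm closure of the compactly supported
   continuous functions. *)
Definition C0 (phi : V -> R) : Prop :=
  {within Omega, continuous phi} /\
  forall e : R, 0 < e -> compact [set x | Omega x /\ e <= `|phi x|].

Local Notation fin_measure := {finite_measure set (borelT R d) -> \bar R}.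

(* A finite signed measure on Omega is given as a difference of two finite
   positive Borel measures; its integrals do not depend on the decomposition. *)
Definition signed_integral (mu : fin_measure * fin_measure) (phi : V -> R) : R :=
  \int[mu.1]_(x in Omega) phi x - \int[mu.2]_(x in Omega) phi x.

Definition is_gradient_measure (u : V -> R)
    (Du : 'I_d.+1 -> fin_measure * fin_measure) : Prop :=
  forall i phi, Cc1 phi ->
    \int[@leb R d]_(x in Omega) (u x * partial i phi x) =
    - signed_integral (Du i) phi.

Definition BV_weak_star_cvg (u_ : nat -> V -> R) (u : V -> R) : Prop :=
  [/\ forall n, L1 (u_ n), L1 u,
      L1dist (u_ n) u @[n --> \oo] --> (0 : \bar R) &
      exists (Du_ : nat -> 'I_d.+1 -> fin_measure * fin_measure)
             (Du : 'I_d.+1 -> fin_measure * fin_measure),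
        [/\ forall n, is_gradient_measure (u_ n) (Du_ n),
            is_gradient_measure u Du &
            forall phi i, C0 phi ->
              signed_integral (Du_ n i) phi @[n --> \oo]
                --> signed_integral (Du i) phi]].

Definition ae_subset (A B : set V) : Prop :=
  {ae @leb R d, forall x, A x -> B x}.
Definition ae_eq_set (A B : set V) : Prop := ae_subset A B /\ ae_subset B A.

Definition Zsets : set (set V) :=
  [set Z : set V | measurable (Z : set (lebT R d)) /\ Z `<=` Omega].

Definition Xsets : set (set V) :=
  [set Z | Zsets Z /\ (perimeter Z < +oo)%E].

End BV.

Section bochner.
Context {R : realType} {d : nat}.
Local Notation V := 'rV[R]_d.+1.
Local Notation mu1 := (@completed_lebesgue_measure R).
Local Notation timeT := (caratheodory_type (mu_ext (wlength (R := R) idfun))).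
Variables (Omega : set V) (T : R).

(* s is an L^1(Omega)-valued simple function on (0,T), with integral J. *)
Definition simple_integral (s : R -> V -> R) (J : V -> R) : Prop :=
  exists (n : nat) (A : 'I_n -> set R) (v : 'I_n -> V -> R),
    [/\ forall i, measurable (A i : set timeT) /\ A i `<=` `]0, T[,
        forall i, L1 Omega (v i),
        s = (fun t x => \sum_i \1_(A i) t * v i x) &
        J = (fun x => \sum_i fine (mu1 (A i)) * v i x)].

(* u : (0,T) -> L^1(Omega) is Bochner integrable, with integral J. *)
Definition bochner_integral (u : R -> V -> R) (J : V -> R) : Prop :=
  [/\ {ae mu1, forall t : timeT, `]0, T[%classic (t : R) -> L1 Omega (u t)},
      L1 Omega J &
      exists (s : nat -> R -> V -> R) (Js : nat -> V -> R),
      [/\ forall n, simple_integral (s n) (Js n),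
          {ae mu1, forall t : timeT, `]0, T[%classic (t : R) ->
            L1dist Omega (u t) (s n t) @[n --> \oo]
              --> (0 : \bar R)},
          (\int[mu1]_(t in `]0%R, T[) L1dist Omega (u t) (s n t))%E
            @[n --> \oo] --> (0 : \bar R) &
          L1dist Omega (Js n) J @[n --> \oo] --> (0 : \bar R)]].

Definition L1L1 (u : R -> V -> R) : Prop := exists J, bochner_integral u J.

Definition Cc1_time (phi : R -> R) : Prop :=
  [/\ forall t, derivable phi t 1, continuous (derive1 phi) &
      exists K : set R,
        [/\ compact K, K `<=` `]0, T[ & forall t, ~ K t -> phi t = 0]].

Definition weak_time_derivative (f df : R -> V -> R) : Prop :=
  forall phi, Cc1_time phi ->
  exists J : V -> R,
    bochner_integral (fun t x => derive1 phi t * f t x) J /\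
    bochner_integral (fun t x => phi t * df t x) (fun x => - J x).

(* f is in W^{1,1}(0,T; L^1(Omega)) with time derivative df. *)
Definition W11 (f df : R -> V -> R) : Prop :=
  [/\ L1L1 f, L1L1 df & weak_time_derivative f df].

(* f is in C([0,T]; L^1(Omega)). *)
Definition CL1 (f : R -> V -> R) : Prop :=
  forall t : R, `[0, T]%classic t ->
    L1 Omega (f t) /\
    L1dist Omega (f s) (f t) @[s --> within `[0, T] (nbhs t)]
      --> (0 : \bar R).

(* Since f is evaluated at every time, it stands for the continuous
   representative of its class in W^{1,1}(0,T; L^1(Omega)). *)
Definition loading (F : R -> set V) (f df : R -> V -> R) : Prop :=
  [/\ forall t : R, `[0, T]%classic t -> open (F t) /\ F t `<=` Omega,
      forall s t : R, 0 <= s -> s <= t -> t <= T -> ae_subset (F s) (F t),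
      W11 f df, CL1 f &
      {ae mu1, forall t : timeT, `]0, T[%classic (t : R) ->
        {ae @leb R d, forall x : lebT R d, Omega x -> 0 <= f t x} /\
        ae_eq_set (F t) [set x | Omega x /\ 0 < f t x]}].

End bochner.

Section rate_independent_system.
Context {R : realType} {d : nat}.
Local Notation V := 'rV[R]_d.+1.
Local Notation mu1 := (@completed_lebesgue_measure R).
Variables (Omega : set V) (T a : R) (k : nat) (f df : R -> V -> R).

Local Open Scope ereal_scope.

Definition dissipation (Z1 Z2 : set V) : \bar R :=
  if `[< ae_subset Z2 Z1 >] then a%:E * @leb R d (Z1 `\` Z2) else +oo.

Definition energy (t : R) (Z : set V) : \bar R :=
  perimeter Omega Z +
  \int[@leb R d]_(x in Omega) (k%:R * f t x * \1_Z x)%:E.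

(* The (left) partial time derivative of the energy at a.e. t, df being the
   time derivative of f; the perimeter term does not depend on time. *)
Definition dt_energy (t : R) (Z : set V) : \bar R :=
  \int[@leb R d]_(x in Omega) (k%:R * df t x * \1_Z x)%:E.

Definition is_partition (N : nat) (t : nat -> R) : Prop :=
  [/\ t 0%N = 0%R, t N = T & forall i, (i < N)%N -> (t i < t i.+1)%R].

Definition step_size (N : nat) (t : nat -> R) : R :=
  \big[Num.max/0%R]_(i < N) (t i.+1 - t i)%R.

Definition discrete_solution (N : nat) (t : nat -> R) (Z0 : set V)
    (Z : nat -> set V) : Prop :=
  [/\ Xsets Omega (Z 0%N), ae_eq_set (Z 0%N) Z0 &
      forall i, (i < N)%N ->
        Xsets Omega (Z i.+1) /\
        forall Z', Xsets Omega Z' ->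
          energy (t i.+1) (Z i.+1) + dissipation (Z i) (Z i.+1) <=
          energy (t i.+1) Z' + dissipation (Z i) Z'].

(* The value at s is Z i for the first node t i with s <= t i. *)
Definition left_interpolant (N : nat) (t : nat -> R) (Z : nat -> set V)
    (s : R) : set V :=
  Z (find (fun i => (s <= t i)%R) (iota 0 N.+1)).

Definition curve_in_X (Z : R -> set V) : Prop :=
  forall t : R, `[0%R, T]%classic t -> Xsets Omega (Z t).

Definition GMM (Z0 : set V) (Z : R -> set V) : Prop :=
  [/\ curve_in_X Z, ae_eq_set (Z 0%R) Z0 &
  exists (tau : nat -> R) (N : nat -> nat) (t : nat -> nat -> R)
         (Zd : nat -> nat -> set V),
  [/\ [/\ forall j, (0 < tau j)%R,
          forall i j, (i <= j)%N -> (tau j <= tau i)%R &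
          tau j @[j --> \oo] --> (0%R : R)],
      forall j, is_partition (N j) (t j) /\ step_size (N j) (t j) = tau j,
      forall j, discrete_solution (N j) (t j) Z0 (Zd j),
      exists2 C : R, (0 < C)%R &
        forall (j : nat) (s : R), `[0%R, T]%classic s ->
          energy s (left_interpolant (N j) (t j) (Zd j) s) <= C%:E &
      forall s : R, `[0%R, T]%classic s ->
        BV_weak_star_cvg Omega
          (fun j => \1_(left_interpolant (N j) (t j) (Zd j) s)) \1_(Z s)]].

Definition stable (t : R) (Z : set V) : Prop :=
  forall Z', Zsets Omega Z' -> energy t Z <= energy t Z' + dissipation Z Z'.

Definition SMM (Z0 : set V) (Z : R -> set V) : Prop :=
  GMM Z0 Z /\ forall t : R, `[0%R, T]%classic t -> stable t (Z t).

Definition energetic_solution (Z : R -> set V) : Prop :=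
  [/\ curve_in_X Z,
      forall s t : R, (0 <= s)%R -> (s <= t)%R -> (t <= T)%R ->
        ae_subset (Z t) (Z s),
      forall t : R, `[0%R, T]%classic t -> stable t (Z t) &
      forall t : R, `[0%R, T]%classic t ->
        mu1.-integrable `[0%R, t] (fun s => dt_energy s (Z s)) /\
        energy t (Z t) + dissipation (Z 0%R) (Z t) =
        energy 0%R (Z 0%R) + \int[mu1]_(s in `[0%R, t]) dt_energy s (Z s)].

End rate_independent_system.

(* Main.v *)
Require Import Defs.
From mathcomp Require Import all_boot all_order all_algebra.
From mathcomp Require Import all_classical all_reals all_analysis measurable_realfun.
From mathcomp Require Import lra ring.
Set Implicit Arguments.
Unset Strict Implicit.
Unset Printing Implicit Defensive.
Import Order.TTheory GRing.Theory Num.Theory.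
Import numFieldNormedType.Exports.
Local Open Scope classical_set_scope.
Local Open Scope ring_scope.

(* For a fixed set Z, the work [\int_Z f t] is absolutely continuous in t with
   derivative the power [\int_Z df t]. Stability of Z(s) against Z(t), summed over
   fine partitions of [s, t], gives the lower energy estimate on every [s, t]. In the
   discrete scheme, comparing Z_i with Z_(i-1) and passing to the limit with the
   lower semicontinuity of the perimeter gives the upper estimate on [0, T]. In both
   sums the integrands converge at almost every time: Z is decreasing, hence
   continuous in measure off a countable set, and [L1norm (df t)] dominates.
   Dissipation being additive along a decreasing curve, the upper estimate on [0, T]
   minus the lower one on [t, T] is the upper estimate on [0, t]. *)
(** * Lebesgue measure on R^n *)

(** The loading is only a Bochner class: [df t] is an $L^1$ function for almost every [t], and the
    power pairs it with a set [Z t] whose only regularity in time is monotonicity. The energy is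
    therefore never differentiated along [Z]. The set is frozen on each interval of a partition,
    where pairing with a fixed set reduces the vector-valued derivative to a scalar one; the moving
    set returns in the limit, which also yields the measurability in time of the power along [Z].
    The lower estimate freezes the set of the right node, the competitor in the stability test; the
    upper one freezes the set before the step, the competitor in the minimisation. A single
    convergence result, [step_power_cvg], covers both. The perimeter is merely lower semicontinuous:
    it may drop in the limit, which is harmless at the end of an upper estimate but not at its
    start. So the discrete scheme is exploited from 0, where the discrete sets agree with [Z 0] up
    to null sets, to [T], which is a node of every partition. *)

Section leb_borel.
Context {R : realType} {d : nat}.
Local Notation V := 'rV[R]_d.+1.
Local Notation L := (lebT R d).

Definition set_coord (i : 'I_d.+1) (c : R) (x : V) : V :=
  \row_j if j == i then c else x ord0 j.

Lemma set_coord_eq i c x : set_coord i c x ord0 i = c.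
Proof. by rewrite mxE eqxx. Qed.

Lemma set_coord_neq i c x j : j != i -> set_coord i c x ord0 j = x ord0 j.
Proof. by rewrite mxE => /negPf ->. Qed.

(** Cutting a box across direction [i] affects only its [i]-th side, and side lengths truncated at 0
    still add up when a piece is empty. *)
Lemma box_volume_split i c (a b : V) :
  box_volume a (set_coord i (Num.min (b ord0 i) c) b) +
  box_volume (set_coord i (Num.max (a ord0 i) c) a) b = box_volume a b.
Proof.
rewrite /box_volume [X in X + _](bigD1 i)//= [X in _ + X](bigD1 i)//=.
rewrite [RHS](bigD1 i)//= !set_coord_eq.
under [X in _ * X + _]eq_bigr do rewrite set_coord_neq//.
under [X in _ + _ * X]eq_bigr do rewrite set_coord_neq//.
rewrite -mulrDl; congr (_ * _).
rewrite /Num.max /Num.min; move: (a ord0 i) (b ord0 i) => x y.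
by repeat case: ifPn; rewrite -?leNgt; lra.
Qed.

(** Caratheodory's criterion: cutting each box of a cover of [X] along the hyperplane gives covers
    of the two parts of [X] with the same total volume. *)
Lemma half_space_measurable i c :
  measurable ([set x : V | x ord0 i <= c] : set L).
Proof.
apply: le_caratheodory_measurable => X /=.
apply: le_ereal_inf_tmp => _ [c' c'X <-].
pose c1 k := ((c' k).1, set_coord i (Num.min ((c' k).2 ord0 i) c) (c' k).2).
pose c2 k := (set_coord i (Num.max ((c' k).1 ord0 i) c) (c' k).1, (c' k).2).
have -> : (\sum_(k <oo) (box_volume (c' k).1 (c' k).2)%:E =
  \sum_(k <oo) (box_volume (c1 k).1 (c1 k).2)%:E +
  \sum_(k <oo) (box_volume (c2 k).1 (c2 k).2)%:E)%E.
  rewrite -nneseriesD; [|by move=> n _ _; rewrite lee_fin box_volume_ge0..].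
  by apply: eq_eseriesr => k _; rewrite -EFinD box_volume_split.
apply: leeD; apply: ereal_inf_lbound.
- exists c1 => // x [Xx xc]; have [k _ kx] := c'X _ Xx; exists k => // j.
  rewrite /c1/=; have /andP[ax xb] := kx j; rewrite ax/=.
  have [->|ji] := eqVneq j i; last by rewrite set_coord_neq.
  by rewrite set_coord_eq le_min xc andbT; have /andP[] := kx i.
- exists c2 => // x [Xx /negP xc]; have [k _ kx] := c'X _ Xx; exists k => // j.
  rewrite /c2/=; have /andP[ax xb] := kx j; rewrite xb andbT.
  have [->|ji] := eqVneq j i; last by rewrite set_coord_neq.
  by rewrite set_coord_eq gt_max (ltNge c) xc andbT; have /andP[] := kx i.
Qed.

Lemma box_measurable (a b : V) : measurable (box a b : set L).
Proof.
have -> : box a b = \bigcap_(i in [set: 'I_d.+1])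
    ([set x : V | x ord0 i <= b ord0 i] `&` ~` [set x : V | x ord0 i <= a ord0 i]).
  apply/seteqP; split=> x /= bx.
    move=> i _; have /andP[ax xb] := bx i; split => //=.
    by apply/negP; rewrite -ltNge.
  move=> i; have [/= -> /negP] := bx i Logic.I.
  by rewrite -ltNge andbT.
apply: fin_bigcap_measurable => // i _.
by apply: measurableI; [|apply: measurableC]; exact: half_space_measurable.
Qed.

(** An open set is the union of the countably many half-open boxes with rational corners that it
    contains. *)
Lemma open_leb_measurable (A : set V) : open A -> measurable (A : set L).
Proof.
move=> oA.
pose q (r : 'rV[rat]_d.+1) : V := map_mx ratr r.
pose B (ab : 'rV[rat]_d.+1 * 'rV[rat]_d.+1) : set V :=
  if `[< box (q ab.1) (q ab.2) `<=` A >] then box (q ab.1) (q ab.2) else set0.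
have -> : A = \bigcup_ab B ab.
  apply/seteqP; split=> [x Ax|x [ab _]]; last first.
    by rewrite /B; case: ifPn => // /asboolP; exact.
  have /nbhs_ballP[e /= e0 eA] := open_nbhs_nbhs (conj oA Ax).
  have qlo i : {r : rat | x ord0 i - e < ratr r < x ord0 i}.
    have /rat_in_itvoo/cid[r] : x ord0 i - e < x ord0 i by rewrite gtrBl.
    by rewrite in_itv => ?; exists r.
  have qhi i : {r : rat | x ord0 i < ratr r < x ord0 i + e}.
    have /rat_in_itvoo/cid[r] : x ord0 i < x ord0 i + e by rewrite ltrDl.
    by rewrite in_itv => ?; exists r.
  have bA : box (q (\row_i sval (qlo i))) (q (\row_i sval (qhi i))) `<=` A.
    move=> y by_; apply: eA; split => // i j; rewrite (ord1 i); have := by_ j.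
    rewrite !mxE; have /andP[l1 l2] := svalP (qlo j).
    have /andP[h1 h2] := svalP (qhi j); move=> /andP[ly yh]; rewrite /ball/= ltr_distlC; apply/andP; split; lra.
  exists (\row_i sval (qlo i), \row_i sval (qhi i)) => //.
  rewrite /B; case: ifPn => [_|/asboolP//] j; rewrite !mxE.
  have /andP[l1 l2] := svalP (qlo j); have /andP[h1 h2] := svalP (qhi j).
  by rewrite l2 ltW.
apply: countable_bigcupT_measurable => //= ab.
by rewrite /B; case: ifPn => // _; exact: box_measurable.
Qed.

Lemma bounded_leb_lty (A : set V) : bounded_set A -> (leb A < +oo)%E.
Proof.
move=> [M [_ /(_ (M + 1))]]; rewrite ltrDl ltr01 => /(_ isT) AM.
(* The cover is one cube padded with empty boxes. Its half-side exceeds the bound [M + 1] because a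
   box omits its lower faces. *)
pose a : V := const_mx (- (M + 2)); pose b : V := const_mx (M + 2).
pose c (k : nat) := if k == 0%N then (a, b) else (0 : V, 0 : V).
have v0 : box_volume (0 : V) 0 = 0.
  by rewrite /box_volume big_ord_recl !mxE subrr maxxx mul0r.
apply: (@le_lt_trans _ _ (box_volume a b)%:E); last by rewrite ltry.
apply: ereal_inf_lbound; exists c.
  move=> x /AM xM; exists 0%N => // i /=; rewrite !mxE.
  have : `|x ord0 i| <= M + 1.
    by apply: le_trans xM; rewrite [leRHS]/Num.norm/= mx_normrE; exact: le_bigmax (ord0, i).
  by rewrite ler_norml => /andP[h1 h2]; apply/andP; split; lra.
rewrite (@nneseries_split _ _ 0%N 1%N); last by move=> k _; rewrite lee_fin box_volume_ge0.
rewrite big_nat1 eseries0 ?adde0// => -[|k]//= _ _.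
by rewrite v0.
Qed.

Lemma continuous_leb_measurable (g : V -> R) : continuous g ->
  measurable_fun setT (g : L -> R).
Proof.
move=> /continuousP cg; apply: (measurability _ (RGenOInfty.measurableE R)) => //.
move=> _ [_ [x ->] <-]; rewrite setTI; apply: open_leb_measurable.
by apply: cg; exact: interval_open.
Qed.

End leb_borel.

(** * Integrals over a varying set *)

Section set_pairing.
Context d (E : measurableType d) (R : realType).
Variable mu : {measure set E -> \bar R}.
Variables (D : set E) (mD : measurable D).
Implicit Types (w v : E -> R) (A B : set E).

(** The set enters as a weight on a fixed domain, so linearity in [w] and comparison of two sets
    both concern integrals over [D]. *)
Definition pairing w A : R := \int[mu]_(x in D) (w x * \1_A x).

Lemma pairing_integrable w A : measurable A ->
  mu.-integrable D (EFin \o w) -> mu.-integrable D (fun x => (w x * \1_A x)%:E).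
Proof.
move=> mA iw; apply: (le_integrable mD _ _ iw).
  apply/measurable_EFinP/measurable_funM => //.
  by apply/measurable_EFinP; case/integrableP: iw.
move=> x _; rewrite lee_fin normrM ler_piMr// indicE.
by case: (_ \in _); rewrite ?normr1 ?normr0.
Qed.

Lemma EFin_pairing w A : measurable A -> mu.-integrable D (EFin \o w) ->
  (\int[mu]_(x in D) (w x * \1_A x)%:E = (pairing w A)%:E)%E.
Proof.
by move=> mA iw; rewrite fineK//; apply: integrable_fin_num => //; exact: pairing_integrable.
Qed.

Lemma pairingZ c w A : measurable A -> mu.-integrable D (EFin \o w) ->
  pairing (fun x => c * w x) A = c * pairing w A.
Proof.
move=> mA iw; rewrite -RintegralZl//; last exact: pairing_integrable.
by apply: eq_Rintegral => x _; rewrite mulrA.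
Qed.

Lemma pairingB w v A : measurable A -> mu.-integrable D (EFin \o w) ->
  mu.-integrable D (EFin \o v) ->
  pairing (fun x => w x - v x) A = pairing w A - pairing v A.
Proof.
move=> mA iw iv; rewrite -RintegralB//; try exact: pairing_integrable.
by apply: eq_Rintegral => x _; rewrite mulrBl.
Qed.

Lemma pairing_sum (I : Type) (s : seq I) (c : I -> R) (w : I -> E -> R) A :
  measurable A -> (forall i, mu.-integrable D (EFin \o w i)) ->
  pairing (fun x => \sum_(i <- s) c i * w i x) A =
  \sum_(i <- s) c i * pairing (w i) A.
Proof.
move=> mA iw; elim: s => [|i s ih].
  rewrite big_nil /pairing /Rintegral integral0_eq// => x _.
  by rewrite big_nil mul0r.
rewrite big_cons -ih -pairingZ//.
have iZ j : mu.-integrable D (EFin \o (fun x => c j * w j x)).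
  exact: (integrableZl mD (c j) (iw j)).
have iS (t : seq I) : mu.-integrable D (EFin \o (fun x => \sum_(i <- t) c i * w i x)).
  have := @integrable_sum _ _ _ mu _ mD _ t xpredT _ (fun j _ => iZ j).
  by under eq_fun do rewrite sumEFin.
rewrite /pairing -RintegralD//; try exact: pairing_integrable.
by apply: eq_Rintegral => x _; rewrite big_cons mulrDl.
Qed.

Lemma le_norm_pairing w A : measurable A -> mu.-integrable D (EFin \o w) ->
  (`|pairing w A|%:E <= \int[mu]_(x in D) `|w x|%:E)%E.
Proof.
move=> mA iw; rewrite EFin_normr_Rintegral//; last exact: pairing_integrable.
have iwA := pairing_integrable mA iw.
apply: (le_trans (le_abse_integral _ mD (measurable_int mu iwA))).
apply: ge0_le_integral => //.
- exact/measurableT_comp/(measurable_int mu iwA).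
- apply/measurable_EFinP/measurableT_comp => //.
  exact/measurable_EFinP/(measurable_int mu iw).
- move=> x _; rewrite /= lee_fin normrM ler_piMr// indicE.
  by case: (_ \in _); rewrite ?normr1 ?normr0.
Qed.

Lemma pairingE w A : A `<=` D -> pairing w A = \int[mu]_(x in A) w x.
Proof.
move=> AD; rewrite -[in RHS](setIidr AD) Rintegral_mkcondr.
apply: eq_Rintegral => x _; rewrite /patch indicE.
by case: ifPn; rewrite ?mulr1 ?mulr0.
Qed.

(** Absolute continuity of the integral: the two values differ by the integrals of [w] over the two
    set differences, each below [e / 2]. The threshold [r] is the same for all pairs of sets. *)
Lemma pairing_abs_cont w : mu.-integrable D (EFin \o w) ->
  forall e, 0 < e -> exists2 r, 0 < r & forall A B,
    measurable A -> measurable B -> A `<=` D -> B `<=` D ->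
    (mu (A `\` B) < r%:E)%E -> (mu (B `\` A) < r%:E)%E ->
    `|pairing w A - pairing w B| < e.
Proof.
move=> iw e e0; have e20 : 0 < e / 2 by rewrite divr_gt0.
have iw' : mu.-integrable setT (EFin \o (w \_ D)).
  by rewrite -restrict_EFin; apply/(integrable_mkcond _ mD).1.
have [r [r0 rP]] := integral_normr_continuous iw' e20.
exists r => // A B mA mB AD BD AB BA.
have small C : measurable C -> C `<=` D -> (mu C < r%:E)%E ->
    `|pairing w C| < e / 2.
  move=> mC CD /(rP _ mC); apply: le_lt_trans; rewrite pairingE//.
  have iwC : mu.-integrable C (EFin \o w) by exact: (integrableS mD).
  apply: (le_trans (le_normr_Rintegral mC iwC)).
  rewrite le_eqVlt; apply/orP; left; apply/eqP/eq_Rintegral => x /set_mem Cx.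
  by rewrite patchE mem_set//; exact: CD.
have mAB : measurable (A `\` B) by exact: measurableD.
have mBA : measurable (B `\` A) by exact: measurableD.
have -> : pairing w A - pairing w B = pairing w (A `\` B) - pairing w (B `\` A).
  rewrite /pairing -!RintegralB//; try exact: pairing_integrable.
  apply: eq_Rintegral => x _; rewrite -!mulrBr !indicE !in_setD.
  by case: (x \in A); case: (x \in B); rewrite /= ?subrr.
rewrite (le_lt_trans (ler_normB _ _))// [ltRHS]splitr ltrD//.
- by apply: small => // x [/AD].
- by apply: small => // x [/BD].
Qed.

Lemma eq_pairing w A B : mu.-integrable D (EFin \o w) ->
  measurable A -> measurable B -> A `<=` D -> B `<=` D ->
  mu (A `\` B) = 0%E -> mu (B `\` A) = 0%E -> pairing w A = pairing w B.
Proof.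
move=> iw mA mB AD BD AB BA; apply/eqP; rewrite -subr_eq0 -normr_le0.
apply/ler_addgt0Pr => e /(pairing_abs_cont iw)[r r0 rP].
by rewrite add0r ltW// rP// ?AB ?BA lte_fin.
Qed.

(** $|1_A-1_B|$ equals 1 on the set difference; this turns $L^1$ convergence of indicators into
    convergence of measures. *)
Lemma measureD_le_indic A B : measurable A -> measurable B -> A `<=` D ->
  (mu (A `\` B) <= \int[mu]_(x in D) `|\1_A x - \1_B x|%:E)%E.
Proof.
move=> mA mB AD; have mAB : measurable (A `\` B) by exact: measurableD.
have <- : (\int[mu]_(x in D) (\1_(A `\` B) x)%:E = mu (A `\` B))%E.
  by rewrite integral_indic// setIidl// => x [/AD].
apply: ge0_le_integral => //.
- exact/measurable_EFinP.
- by apply/measurable_EFinP/measurableT_comp => //; exact: measurable_funB.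
- move=> x _; rewrite lee_fin !indicE in_setD.
  by case: (x \in A); case: (x \in B); rewrite /= ?subr0 ?sub0r ?normrN ?subrr ?normr0 ?normr1.
Qed.

Lemma integral_norm_triangle u v w : mu.-integrable D (EFin \o u) ->
  mu.-integrable D (EFin \o v) -> mu.-integrable D (EFin \o w) ->
  (forall x, `|u x| <= `|v x| + `|w x|) ->
  (\int[mu]_(x in D) `|u x|%:E <=
   \int[mu]_(x in D) `|v x|%:E + \int[mu]_(x in D) `|w x|%:E)%E.
Proof.
move=> iu iv iw uvw.
have mn z : mu.-integrable D (EFin \o z) -> measurable_fun D (fun x => `|z x|%:E).
  move=> /(measurable_int mu) /measurable_EFinP mz.
  exact/measurable_EFinP/measurableT_comp.
rewrite -ge0_integralD//; try exact: mn.
apply: ge0_le_integral => //; first exact: mn.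
- by apply: emeasurable_funD; exact: mn.
- by move=> x _; rewrite -EFinD lee_fin.
Qed.

Lemma measureD_triangle A B C : measurable A -> measurable B -> measurable C ->
  (mu (A `\` C) <= mu (A `\` B) + mu (B `\` C))%E.
Proof.
move=> mA mB mC; have mAB := measurableD mA mB; have mBC := measurableD mB mC.
apply: le_trans (measureU2 mu mAB mBC); rewrite le_measure ?inE//.
- exact: measurableD.
- exact: measurableU.
- by move=> x [Ax Cx]; have [Bx|Bx] := pselect (B x); [right|left].
Qed.

End set_pairing.

(** * Integrals of possibly nonmeasurable functions, and completeness *)

Section ae_integration.
Context d (E : measurableType d) (R : realType).
Variable mu : {measure set E -> \bar R}.
Local Open Scope ereal_scope.

(** The integral of a nonnegative function is a supremum over the simple functions below it, so it
    is monotone even where measurability fails. *)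
Lemma ge0_nonmeasurable_le_integral (D D' : set E) (f g : E -> \bar R) :
  (forall x, D x -> 0 <= f x) -> (forall x, D' x -> 0 <= g x) -> D `<=` D' ->
  (forall x, D x -> f x <= g x) ->
  \int[mu]_(x in D) f x <= \int[mu]_(x in D') g x.
Proof.
move=> f0 g0 DD' fg; rewrite !ge0_integralE//.
apply: ge_ereal_sup => _ [h hf <-]; apply: ereal_sup_ubound; exists h => // x.
apply: (le_trans (hf x)); rewrite !patchE.
case: ifPn => [/set_mem Dx|_]; last by case: ifPn => // /set_mem /g0.
by rewrite mem_set ?fg//; exact: DD'.
Qed.

(* [bochner_integral] does not ask [t |-> L1dist (u t) (s n t)] to be measurable;
   this is the role of [g] here. *)
Lemma ae_ge0_nonmeasurable_le_integral (D : set E) (f g : E -> \bar R) :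
  measurable D -> measurable_fun D f ->
  (forall x, D x -> 0 <= f x) -> (forall x, D x -> 0 <= g x) ->
  {ae mu, forall x, D x -> f x <= g x} ->
  \int[mu]_(x in D) f x <= \int[mu]_(x in D) g x.
Proof.
move=> mD mf f0 g0 [N [mN muN fgN]].
rewrite (ge0_negligible_integral mN mD mf f0 muN).
apply: ge0_nonmeasurable_le_integral => //.
- by move=> x [/f0].
- by move=> x [Dx]; apply: contra_notP => fg; apply: fgN => /= /(_ Dx).
Qed.

(** The upper limit of the [f_ n] is measurable and agrees with [f] almost everywhere; completeness
    of [mu] transfers measurability to [f]. *)
Lemma ae_cvg_measurable (D : set E) (f_ : nat -> E -> \bar R) (f : E -> \bar R) :
  measure_is_complete mu ->
  (forall n, measurable_fun D (f_ n)) ->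
  {ae mu, forall x, D x -> f_ n x @[n --> \oo] --> f x} ->
  measurable_fun D f.
Proof.
move=> cmu mf ff.
have mg := measurable_fun_limn_esup mf.
apply: (ae_measurable_fun cmu _ mg); apply: filterS ff => x /[apply] /cvg_limn_einf_sup[_].
by [].
Qed.

(** As [g] may be nonmeasurable, the integral of [C + g] cannot be split. The positive part of
    [G - C] is measurable and almost everywhere below [g], and [G] is at most that part plus [C]. *)
Lemma ae_le_nonmeasurable_integrable (D : set E) (G g : E -> \bar R) (C : R) :
  measurable D -> mu D < +oo -> measurable_fun D G ->
  (forall x, D x -> 0 <= G x) -> (forall x, D x -> 0 <= g x) -> (0 <= C)%R ->
  {ae mu, forall x, D x -> G x <= C%:E + g x} ->
  \int[mu]_(x in D) g x < +oo -> mu.-integrable D G.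
Proof.
move=> mD muD mG G0 g0 C0 Gg ig; apply/integrableP; split => //.
pose f x := maxe (G x - C%:E) 0.
have mf : measurable_fun D f.
  by apply: measurable_maxe => //; exact: emeasurable_funB.
have f0 x : 0 <= f x by rewrite le_max lexx orbT.
have fg : \int[mu]_(x in D) f x <= \int[mu]_(x in D) g x.
  apply: ae_ge0_nonmeasurable_le_integral => //.
  apply: filterS Gg => x Gg Dx.
  by rewrite ge_max g0// andbT leeBlDr// addeC; exact: Gg.
apply: (@le_lt_trans _ _ (\int[mu]_(x in D) (f x + C%:E))).
  apply: ge0_le_integral => //.
  - exact: measurableT_comp.
  - exact: emeasurable_funD.
  - by move=> x Dx; rewrite gee0_abs ?G0// -leeBlDr// le_max lexx.
rewrite ge0_integralD// integral_cst// lte_add_pinfty//.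
  exact: le_lt_trans ig.
exact: lte_mul_pinfty.
Qed.

End ae_integration.

(** * Completed Lebesgue measure on the time axis *)

Section time_measure.
Context {R : realType}.
Local Notation mu1 := (@completed_lebesgue_measure R).
Local Notation timeT := (caratheodory_type (mu_ext (wlength (R := R) idfun))).

Lemma borel_time_measurable (A : set R) :
  measurable (A : set (measurableTypeR R)) -> measurable (A : set timeT).
Proof. exact: sub_caratheodory. Qed.

Lemma itv_time_measurable (i : interval R) : measurable ([set` i] : set timeT).
Proof. by apply: borel_time_measurable; exact: measurable_itv. Qed.

Lemma time_measure_itv (i : interval R) :
  mu1 [set` i] = (if i.1 < i.2 then (i.2 : \bar R) - i.1 else 0)%E.
Proof. exact: lebesgue_measure_itv. Qed.

Lemma time_measure1 (x : R) : mu1 [set x] = 0%E.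
Proof. exact: lebesgue_measure_set1. Qed.

Lemma continuous_time_measurable (g : R -> R) : continuous g ->
  measurable_fun setT (g : timeT -> R).
Proof.
move=> /continuous_measurable_fun mg _ Y mY.
by apply: borel_time_measurable; exact: mg.
Qed.

(** The identity from the completed sigma-algebra to the Borel one is measurable and pushes [mu1]
    forward to Lebesgue measure. This makes the fundamental theorem of calculus applicable to
    [mu1]. *)
Lemma time_integral_continuous (g : R -> R) (i : interval R) : continuous g ->
  (\int[mu1]_(x in [set` i]) (g x)%:E = \int[lebesgue_measure]_(x in [set` i]) (g x)%:E)%E.
Proof.
move=> cg.
pose phi : timeT -> measurableTypeR R := idfun.
have mphi : measurable_fun setT phi.
  by move=> _ Y mY; rewrite setTI; exact: borel_time_measurable.
have mg : measurable_fun [set` i] (EFin \o g : measurableTypeR R -> _).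
  apply/measurable_EFinP; apply: (@measurable_funTS _ _ (measurableTypeR R)).
  exact: continuous_measurable_fun.
have E D (h : R -> \bar R) : measurable (D : set (measurableTypeR R)) ->
    measurable_fun D (h : measurableTypeR R -> _) ->
    (forall x, D x -> 0 <= h x)%E ->
    (\int[mu1]_(x in D) h x = \int[lebesgue_measure]_(x in D) h x)%E.
  move=> mD mh h0.
  rewrite -[LHS](@ge0_integral_pushforward _ _ timeT (measurableTypeR R) R phi mphi mu1 D h)//.
  by move=> x /set_mem /h0.
rewrite integralE [RHS]integralE.
by congr (_ - _)%E; apply: E => //; [exact: measurable_funepos|exact: measurable_funeneg].
Qed.

End time_measure.

(** * Bochner integrals paired with sets *)

Lemma cvge0_lt {R : realType} (u : nat -> \bar R) (e : R) :
  u n @[n --> \oo] --> 0%E -> 0 < e -> \forall n \near \oo, (u n < e%:E)%E.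
Proof.
move=> u0 e0; apply: (u0 [set x | (x < e%:E)%E]); apply: open_nbhs_nbhs; split.
  exact: open_ereal_lt_ereal.
by rewrite /= lte_fin.
Qed.

Section L1_space.
Context {R : realType} {d : nat}.
Local Notation V := 'rV[R]_d.+1.
Local Notation muV := (@leb R d).
Variable Omega : set V.
Hypothesis mOmega : measurable (Omega : set (lebT R d)).
Implicit Types u v w : V -> R.

Lemma L1_sub u v : L1 Omega u -> L1 Omega v -> L1 Omega (fun x => u x - v x).
Proof. by move=> iu iv; exact: (integrableB mOmega iu iv). Qed.

Lemma L1_scale c u : L1 Omega u -> L1 Omega (fun x => c * u x).
Proof. by move=> iu; exact: (integrableZl mOmega c iu). Qed.

Lemma L1_sum (I : Type) (r : seq I) (c : I -> R) (v : I -> V -> R) :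
  (forall i, L1 Omega (v i)) -> L1 Omega (fun x => \sum_(i <- r) c i * v i x).
Proof.
move=> iv; have := @integrable_sum _ _ _ muV _ mOmega _ r xpredT _
  (fun j _ => L1_scale (c j) (iv j)).
by rewrite /L1; under eq_fun do rewrite sumEFin.
Qed.

Lemma L1norm_ge0 u : (0 <= L1norm Omega u)%E.
Proof. by apply: integral_ge0 => x _; rewrite lee_fin. Qed.

Lemma L1norm_lty u : L1 Omega u -> (L1norm Omega u < +oo)%E.
Proof. by move=> /integrableP[]. Qed.

Lemma L1norm_fin_num u : L1 Omega u -> L1norm Omega u \is a fin_num.
Proof. by move=> iu; rewrite ge0_fin_numE ?L1norm_ge0// L1norm_lty. Qed.

Lemma L1norm_triangle u v w : L1 Omega u -> L1 Omega v -> L1 Omega w ->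
  (forall x, `|u x| <= `|v x| + `|w x|) ->
  (L1norm Omega u <= L1norm Omega v + L1norm Omega w)%E.
Proof. exact: integral_norm_triangle. Qed.

Lemma L1norm_le_distl u v : L1 Omega u -> L1 Omega v ->
  (L1norm Omega u <= L1norm Omega v + L1dist Omega u v)%E.
Proof.
move=> iu iv; apply: L1norm_triangle => //; first exact: L1_sub.
by move=> x; rewrite -{1}(subrKC (v x) (u x)) ler_normD.
Qed.

Lemma L1norm_le_distr u v : L1 Omega u -> L1 Omega v ->
  (L1norm Omega v <= L1norm Omega u + L1dist Omega u v)%E.
Proof.
move=> iu iv; apply: L1norm_triangle => //; first exact: L1_sub.
by move=> x; rewrite -{1}(subKr (u x) (v x)) ler_normB.
Qed.

Lemma pairing_dist_le u v (A : set V) : measurable (A : set (lebT R d)) ->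
  L1 Omega u -> L1 Omega v ->
  (`|pairing muV Omega u A - pairing muV Omega v A|%:E <= L1dist Omega u v)%E.
Proof.
move=> mA iu iv; rewrite -pairingB//; apply: le_norm_pairing => //.
exact: L1_sub.
Qed.

Lemma cvg_L1dist_pairing (u_ : nat -> V -> R) u (A : set V) :
  measurable (A : set (lebT R d)) ->
  (forall n, L1 Omega (u_ n)) -> L1 Omega u ->
  L1dist Omega (u_ n) u @[n --> \oo] --> 0%E ->
  pairing muV Omega (u_ n) A @[n --> \oo] --> pairing muV Omega u A.
Proof.
move=> mA iu_ iu uu; apply/cvgrPdist_lt => e e0.
have : \forall n \near \oo, (L1dist Omega (u_ n) u < e%:E)%E.
  exact: cvge0_lt.
apply: filterS => n dn; rewrite distrC -lte_fin.
exact: le_lt_trans (pairing_dist_le mA (iu_ n) iu) dn.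
Qed.

Lemma cvg_L1norm (u_ : nat -> V -> R) u :
  (forall n, L1 Omega (u_ n)) -> L1 Omega u ->
  L1dist Omega u (u_ n) @[n --> \oo] --> 0%E ->
  L1norm Omega (u_ n) @[n --> \oo] --> L1norm Omega u.
Proof.
move=> iu_ iu uu; have fu := L1norm_fin_num iu.
apply: (@squeeze_cvge _ _ _ _ (fun n => L1norm Omega u - L1dist Omega u (u_ n))%E
  _ (fun n => L1norm Omega u + L1dist Omega u (u_ n))%E).
- near=> n; rewrite L1norm_le_distr// andbT leeBlDr ?L1norm_le_distl//.
  by apply: L1norm_fin_num; exact: L1_sub.
- rewrite -[X in _ --> X]sube0; apply: cvgeB => //; first by rewrite fin_num_adde_defl.
  exact: cvg_cst.
- rewrite -[X in _ --> X]adde0; apply: cvgeD => //; first by rewrite fin_num_adde_defl.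
  exact: cvg_cst.
Unshelve. all: by end_near. Qed.

End L1_space.

Section bochner_pairing.
Context {R : realType} {d : nat}.
Local Notation V := 'rV[R]_d.+1.
Local Notation muV := (@leb R d).
Local Notation mu1 := (@completed_lebesgue_measure R).
Local Notation timeT := (caratheodory_type (mu_ext (wlength (R := R) idfun))).
Variables (Omega : set V) (T : R).
Hypothesis mOmega : measurable (Omega : set (lebT R d)).
Local Notation I0T := (`]0%R, T[%classic : set timeT).

Lemma mu1_I0T_lty : (mu1 I0T < +oo)%E.
Proof. by rewrite time_measure_itv/=; case: ifP => // _; rewrite -EFinB ltry. Qed.

(* A simple function takes finitely many values, each on a measurable set. *)
Lemma simple_comp_measurable s J (Psi : (V -> R) -> \bar R) :
  simple_integral Omega T s J -> measurable_fun setT (fun t : timeT => Psi (s t)).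
Proof.
move=> [n [A [v [mA _ -> _]]]] _ Y _; rewrite setTI.
pose code (t : R) : {ffun 'I_n -> bool} := [ffun i => t \in A i].
pose val_ (b : {ffun 'I_n -> bool}) x := \sum_i (b i)%:R * v i x.
have codeE t : (fun x => \sum_i \1_(A i) t * v i x) = val_ (code t).
  by apply/funext => x; apply: eq_bigr => i _; rewrite indicE ffunE.
have -> : (fun t => Psi (fun x => \sum_i \1_(A i) t * v i x)) @^-1` Y =
    \bigcup_(b in [set b | Y (Psi (val_ b))])
      \bigcap_(i in [set: 'I_n]) (if b i then A i else ~` A i).
  apply/seteqP; split=> [t /=|t [b /= Yb bt]]; rewrite codeE; last first.
    suff -> : code t = b by [].
    apply/ffunP => i; have := bt i Logic.I; rewrite ffunE.
    by case: (b i) => [/mem_set//|h]; apply/negbTE/negP => /set_mem.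
  move=> Yt; exists (code t) => // i _; rewrite ffunE.
  by case: ifPn => [/set_mem//|/negP h]; apply: contra_not h => /mem_set.
apply: fin_bigcup_measurable => // b _.
apply: fin_bigcap_measurable => // i _.
by case: ifP => _; [|apply: measurableC]; exact: (mA i).1.
Qed.

Lemma simple_L1 s J t : simple_integral Omega T s J -> L1 Omega (s t).
Proof. by move=> [n [A [v [_ iv -> _]]]]; exact: L1_sum. Qed.

Lemma simple_integral_L1 s J : simple_integral Omega T s J -> L1 Omega J.
Proof. by move=> [n [A [v [_ iv _ ->]]]]; exact: L1_sum. Qed.

Lemma simple_L1norm_bounded s J : simple_integral Omega T s J ->
  exists2 C, 0 <= C & forall t, (L1norm Omega (s t) <= C%:E)%E.
Proof.
move=> [n [A [v [_ iv -> _]]]].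
exists (\sum_(i < n) fine (L1norm Omega (v i))).
  by apply: sumr_ge0 => i _; rewrite fine_ge0// L1norm_ge0.
move=> t; have : forall r : seq 'I_n,
    (L1norm Omega (fun x => \sum_(i <- r) \1_(A i) t * v i x)%R <=
     (\sum_(i <- r) fine (L1norm Omega (v i)))%R%:E)%E; last exact.
elim=> [|i r ih].
  rewrite big_nil /L1norm integral0_eq// => x _.
  by rewrite big_nil normr0.
rewrite big_cons EFinD fineK ?L1norm_fin_num//.
apply: le_trans (leeD2l _ ih); apply: L1norm_triangle => //; [exact: L1_sum..|].
move=> x; rewrite big_cons (le_trans (ler_normD _ _))// lerD2r normrM indicE.
by case: (_ \in _); rewrite ?normr1 ?normr0 ?mul1r ?mul0r.
Qed.

(** Both sides are linear in the finitely many values [v i], and a single term integrates to the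
    length of its time set times the pairing of [v i]. *)
Lemma simple_pairing s J A : measurable (A : set (lebT R d)) ->
  simple_integral Omega T s J ->
  mu1.-integrable I0T (fun t => (pairing muV Omega (s t) A)%:E) /\
  (\int[mu1]_(t in I0T) (pairing muV Omega (s t) A)%:E =
   (pairing muV Omega J A)%:E)%E.
Proof.
move=> mA sJ; have ms := simple_comp_measurable (fun w => (pairing muV Omega w A)%:E) sJ.
have mI : measurable I0T by exact: itv_time_measurable.
split.
  have [C C0 sC] := simple_L1norm_bounded sJ.
  apply: (measurable_bounded_integrable mI mu1_I0T_lty).
    by apply: measurable_funTS; exact/measurable_EFinP.
  exists C; split; first exact: num_real.
  move=> M CM t _ /=; apply: le_trans (ltW CM); rewrite -lee_fin.
  apply: le_trans (sC t); apply: le_norm_pairing => //; exact: (simple_L1 _ sJ).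
have {ms} _ := ms.
case: sJ => [n [B [v [mB iv -> ->]]]].
rewrite pairing_sum// -sumEFin.
have mB' i : measurable (B i : set timeT) by exact: (mB i).1.
have iB i : mu1.-integrable I0T (EFin \o (\1_(B i) : timeT -> R)).
  apply: (measurable_bounded_integrable mI mu1_I0T_lty) => //.
  exists 1; split; first exact: num_real.
  move=> M M1 t _ /=; apply: le_trans (ltW M1).
  by rewrite indicE; case: (_ \in _); rewrite ?normr1 ?normr0.
under eq_integral => t _ do rewrite pairing_sum// -sumEFin.
rewrite integral_sum//=; last first.
  move=> i; apply: eq_integrable (integrableZl mI (pairing muV Omega (v i) A) (iB i)) => //.
  by move=> x _; rewrite /= -EFinM mulrC.
apply: eq_bigr => i _.
under eq_integral => t _ do rewrite mulrC EFinM.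
rewrite (integralZl mI (iB i)) EFinM muleC; congr (_ * _)%E.
rewrite integral_indic// setIidl; last exact: (mB i).2.
rewrite fineK// ge0_fin_numE//; apply: le_lt_trans mu1_I0T_lty.
by apply: le_measure; rewrite ?inE//; exact: (mB i).2.
Qed.

Variables (u : R -> V -> R) (J : V -> R).
Hypothesis uJ : bochner_integral Omega T u J.

(** The norm is measurable as an almost everywhere limit of norms of simple functions. It is
    dominated through a single simple function: a bounded norm plus a distance of finite
    integral. *)
Lemma bochner_L1norm_integrable :
  mu1.-integrable I0T (fun t => L1norm Omega (u t)).
Proof.
case: uJ => iu _ [s [Js [sJ su isu _]]].
have mI : measurable I0T by exact: itv_time_measurable.
have mG : measurable_fun I0T (fun t : timeT => L1norm Omega (u t)).
  apply: (@ae_cvg_measurable _ _ _ mu1 _ (fun n t => L1norm Omega (s n t))).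
  - exact: completed_lebesgue_measure_is_complete.
  - by move=> n; apply: measurable_funTS; exact: (simple_comp_measurable _ (sJ n)).
  - apply: filterS2 iu su => t iut sut It; apply: cvg_L1norm => //.
    + by move=> n; exact: (simple_L1 _ (sJ n)).
    + exact: iut.
    + exact: sut.
have [n _ /(_ n (leqnn _)) isn] := cvge0_lt isu ltr01.
have [C C0 sC] := simple_L1norm_bounded (sJ n).
apply: (@ae_le_nonmeasurable_integrable _ _ _ mu1 I0T _
    (fun t => L1dist Omega (u t) (s n t)) C mI mu1_I0T_lty mG).
- by move=> t _; exact: L1norm_ge0.
- by move=> t _; exact: L1norm_ge0.
- exact: C0.
- apply: filterS iu => t iut It.
  apply: (le_trans (L1norm_le_distl mOmega (iut It) (simple_L1 t (sJ n)))).
  by rewrite leeD2r.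
- by apply: (lt_trans isn); rewrite ltry.
Qed.

(** Pairing with a fixed set is a bounded linear functional on $L^1$, so it commutes with the
    Bochner integral: the pairings of [Js n] converge both to that of [J] and to the integral of the
    pairings of [u]. *)
Lemma bochner_pairing A : measurable (A : set (lebT R d)) ->
  mu1.-integrable I0T (fun t => (pairing muV Omega (u t) A)%:E) /\
  (\int[mu1]_(t in I0T) (pairing muV Omega (u t) A)%:E =
   (pairing muV Omega J A)%:E)%E.
Proof.
move=> mA; have iG := bochner_L1norm_integrable.
case: uJ => iu iJ [s [Js [sJ su isu JsJ]]].
have mI : measurable I0T by exact: itv_time_measurable.
pose h t := pairing muV Omega (u t) A.
pose h_ n t := pairing muV Omega (s n t) A.
have mh : measurable_fun I0T (fun t : timeT => (h t)%:E).
  apply: (@ae_cvg_measurable _ _ _ mu1 _ (fun n t => (h_ n t)%:E)).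
  - exact: completed_lebesgue_measure_is_complete.
  - by move=> n; apply: measurable_funTS;
      exact: (simple_comp_measurable (fun w => (pairing muV Omega w A)%:E) (sJ n)).
  - apply: filterS2 iu su => t iut sut It; apply/cvg_EFin; first exact: nearW.
    apply/cvgrPdist_lt => e e0.
    apply: filterS (cvge0_lt (sut It) e0) => n dn; rewrite -lte_fin.
    apply: le_lt_trans dn; apply: pairing_dist_le => //; first exact: iut.
    exact: (simple_L1 _ (sJ n)).
have ih : mu1.-integrable I0T (fun t => (h t)%:E).
  apply/integrableP; split => //; have /integrableP[_] := iG.
  apply: le_lt_trans; apply: (@ae_ge0_nonmeasurable_le_integral _ _ _ mu1 I0T
    (fun t => `|(h t)%:E|%E) (fun t => `|L1norm Omega (u t)|%E) mI).
  - exact: measurableT_comp mh.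
  - by move=> t _; exact: abse_ge0.
  - by move=> t _; exact: abse_ge0.
  - apply: filterS iu => t iut It; rewrite [leRHS]gee0_abs ?L1norm_ge0//.
    exact: (le_norm_pairing mOmega mA (iut It)).
split=> //.
have fh := integrable_fin_num mI ih.
rewrite -(fineK fh); congr EFin.
have lim1 : pairing muV Omega (Js n) A @[n --> \oo] --> pairing muV Omega J A.
  by apply: cvg_L1dist_pairing => // n; exact: simple_integral_L1 (sJ n).
have lim2 : pairing muV Omega (Js n) A @[n --> \oo] -->
    fine (\int[mu1]_(t in I0T) (h t)%:E)%E.
  apply/cvgrPdist_lt => e e0.
  apply: filterS (cvge0_lt isu e0) => n dn; rewrite -lte_fin.
  apply: le_lt_trans dn.
  have [ihn hnE] := simple_pairing mA (sJ n).
  rewrite [X in (`|_ - X|)%:E](_ : _ = fine (\int[mu1]_(t in I0T) (h_ n t)%:E)%E); last first.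
    by rewrite hnE.
  rewrite -(fineB fh (integrable_fin_num mI ihn)).
  have /= <- := integralB mI ih ihn.
  have ihB := integrableB mI ih ihn.
  rewrite -[X in (X <= _)%E]/(`|(fine _)%:E|)%E fineK; last exact: integrable_fin_num.
  apply: (le_trans (le_abse_integral _ mI (measurable_int mu1 ihB))).
  apply: (@ae_ge0_nonmeasurable_le_integral _ _ _ mu1 I0T
    (fun t => `|(h t)%:E - (h_ n t)%:E|%E)
    (fun t => L1dist Omega (u t) (s n t)) mI).
  - exact: measurableT_comp (measurable_int mu1 ihB).
  - by move=> t _; exact: abse_ge0.
  - by move=> t _; exact: L1norm_ge0.
  - apply: filterS iu => t iut It; apply: pairing_dist_le => //; first exact: iut.
    exact: (simple_L1 _ (sJ n)).
exact: cvg_unique lim2 lim1.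
Qed.

End bochner_pairing.

(** * From the weak derivative to increments *)

Section ramp.
Context {R : realType}.
Implicit Types x m c : R.

Definition pos_part x : R := Num.max 0 x.
Definition pos_sq x : R := pos_part x ^+ 2.

Lemma pos_continuous : continuous pos_part.
Proof. by move=> x; apply: continuous_max; [exact: cvg_cst|exact: cvg_id]. Qed.

(** The quadratic remainder holds across the kink of [pos_part] at 0, so the derivative of [pos_sq]
    is found for all [x] at once. *)
Lemma pos_sq_taylor x h : `|pos_sq (h + x) - pos_sq x - 2 * pos_part x * h| <= h ^+ 2.
Proof.
rewrite /pos_sq /pos_part /Num.max ler_norml; case: ifPn => h1; case: ifPn => h2;
  rewrite -?leNgt in h1 h2; apply/andP; split; nra.
Qed.

Lemma is_derive_pos_sq x : is_derive x 1 pos_sq (2 * pos_part x).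
Proof.
have dq : h^-1 *: (pos_sq (h *: 1 + x) - pos_sq x) @[h --> 0^'] --> 2 * pos_part x.
  apply/cvgrPdist_le => e e0; near=> h.
  have h0 : h != 0 by near: h; exact: nbhs_dnbhs_neq.
  rewrite distrC -(@ler_pM2l _ `|h|) ?normr_gt0// -normrM.
  have -> : h * (h^-1 *: (pos_sq (h *: 1 + x) - pos_sq x) - 2 * pos_part x) =
      pos_sq (h + x) - pos_sq x - 2 * pos_part x * h.
    rewrite /GRing.scale/= mulr1 mulrBr mulrA divff// mul1r; ring.
  apply: (le_trans (pos_sq_taylor _ _)); rewrite -[h ^+ 2]ger0_norm ?sqr_ge0// expr2 normrM.
  rewrite ler_pM2l ?normr_gt0//.
  by near: h; apply: dnbhs0_le.
by split; [exact: cvgP dq|exact: cvg_lim dq].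
Unshelve. all: by end_near. Qed.

(* The quadratic spline that is C^1, equals 0 for x <= 0 and 1 for x >= 2; its
   derivative is [tent]. *)
Definition ramp x : R := (pos_sq x - 2 * pos_sq (x - 1) + pos_sq (x - 2)) / 2.
(** The hat function: slope 1 on $[0,1]$, slope $-1$ on $[1,2]$, zero elsewhere. *)
Definition tent x : R := pos_part x - 2 * pos_part (x - 1) + pos_part (x - 2).

Lemma is_derive_ramp m c x :
  is_derive x 1 (fun r => ramp (m * r + c)) (m * tent (m * x + c)).
Proof.
have dq c' : is_derive x 1 (fun r => pos_sq (m * r + c')) (2 * pos_part (m * x + c') * m).
  have dl : is_derive x 1 (fun r => m * r + c') m.
    apply: is_derive_eq; rewrite /GRing.scale/=; ring.
  have dp := is_derive_pos_sq (m * x + c').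
  exact: is_derive1_comp.
pose Q c' r := pos_sq (m * r + c').
have d0 : is_derive x 1 (Q c) _ := dq c.
have d1 : is_derive x 1 (Q (c - 1)) _ := dq (c - 1).
have d2 : is_derive x 1 (Q (c - 2)) _ := dq (c - 2).
have -> : (fun r => ramp (m * r + c)) =
    2^-1 \*: (Q c - (2 \*: Q (c - 1)) + Q (c - 2)).
  apply/funext => r.
  rewrite -[RHS]/(2^-1 * (pos_sq (m * r + c) - 2 * pos_sq (m * r + (c - 1)) +
    pos_sq (m * r + (c - 2)))).
  by rewrite /ramp mulrC !addrA.
by apply: is_derive_eq; rewrite /tent !addrA /GRing.scale/=; field.
Qed.

Lemma tent_continuous : continuous tent.
Proof.
move=> x; apply: cvgD; first apply: cvgB; first exact: pos_continuous.
- apply: cvgM; first exact: cvg_cst.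
  apply: (@continuous_comp _ _ _ (fun x => x - 1) pos_part); last exact: pos_continuous.
  by apply: cvgB; [exact: cvg_id|exact: cvg_cst].
- apply: (@continuous_comp _ _ _ (fun x => x - 2) pos_part); last exact: pos_continuous.
  by apply: cvgB; [exact: cvg_id|exact: cvg_cst].
Qed.

Lemma tent_ge0 x : 0 <= tent x.
Proof. by rewrite /tent /pos_part /Num.max; do 3 case: ltP => ?; lra. Qed.

Lemma tent_le1 x : tent x <= 1.
Proof. by rewrite /tent /pos_part /Num.max; do 3 case: ltP => ?; lra. Qed.

Lemma tent_supp x : tent x != 0 -> 0 <= x <= 2.
Proof.
apply: contraNT; rewrite negb_and -!ltNge => /orP[] h; apply/eqP;
by rewrite /tent /pos_part /Num.max; do 3 case: ltP => ?; lra.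
Qed.

Lemma ramp0 x : x <= 0 -> ramp x = 0.
Proof.
move=> x0; rewrite /ramp /pos_sq /pos_part !max_l; [|lra|lra|lra].
by rewrite expr0n /=; lra.
Qed.

Lemma ramp1 x : 2 <= x -> ramp x = 1.
Proof.
move=> x2; rewrite /ramp /pos_sq /pos_part !max_r; [|lra|lra|lra].
by field.
Qed.

Lemma ramp_bounds x : 0 <= ramp x <= 1.
Proof.
rewrite /ramp /pos_sq /pos_part /Num.max; do 3 case: ltP => ?; apply/andP; split; nra.
Qed.

End ramp.

Section weak_derivative.
Context {R : realType}.
Local Notation mu1 := (@completed_lebesgue_measure R).
Local Notation timeT := (caratheodory_type (mu_ext (wlength (R := R) idfun))).
Variable T : R.
Local Notation I0T := (`]0%R, T[%classic : set timeT).

(** For positive [m], a hat of mass 1 and width [2 / m]: an approximate Dirac mass as [m] grows. *)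
Definition bump (m c r : R) : R := m * tent (m * r + c).

Lemma bump_continuous m c : continuous (bump m c).
Proof.
move=> x; apply: cvgM; first exact: cvg_cst.
apply: (@continuous_comp _ _ _ (fun x => m * x + c) tent); last exact: tent_continuous.
by apply: cvgD; [apply: cvgM; [exact: cvg_cst|exact: cvg_id]|exact: cvg_cst].
Qed.

Lemma bump_ge0 m c r : 0 <= m -> 0 <= bump m c r.
Proof. by move=> m0; rewrite mulr_ge0// tent_ge0. Qed.

Lemma derive1_ramp m c : derive1 (fun r : R => ramp (m * r + c)) = bump m c.
Proof.
apply/funext => x; rewrite derive1E.
by have dx := is_derive_ramp m c x; rewrite derive_val.
Qed.

Lemma derivable_ramp m c x : derivable (fun r : R => ramp (m * r + c)) x 1.
Proof. by have dx := is_derive_ramp m c x; exact: ex_derive. Qed.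

Lemma ramp_continuous m c : continuous (fun r : R => ramp (m * r + c)).
Proof.
by move=> x; apply/differentiable_continuous/derivable1_diffP; exact: derivable_ramp.
Qed.

(** The two inequalities on [c] make the primitive, a rescaled ramp, equal to 0 at [r = 0] and to 1
    at [r = T]. *)
Lemma bump_integral m c : 0 < T -> c <= 0 -> 2 <= m * T + c ->
  (\int[mu1]_(r in I0T) (bump m c r)%:E = 1)%E.
Proof.
move=> T0 c0 cT; rewrite time_integral_continuous; last exact: bump_continuous.
rewrite -(@integral_itv_bndoo _ _ _ _ true false); last first.
  apply/measurable_EFinP; apply: (@measurable_funTS _ _ (measurableTypeR R)).
  by apply: continuous_measurable_fun; exact: bump_continuous.
rewrite (@continuous_FTC2 _ _ (fun r : R => ramp (m * r + c)))//.
- by rewrite mulr0 add0r (ramp0 c0) (ramp1 cT) -EFinB subr0.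
- exact/continuous_subspaceT/bump_continuous.
- split.
  + by move=> x _; exact: derivable_ramp.
  + by apply: cvg_at_right_filter; exact: ramp_continuous.
  + by apply: cvg_at_left_filter; exact: ramp_continuous.
- by move=> x _; rewrite derive1_ramp.
Qed.

(** The test functions are smoothed indicators of the interval from [s] to [t]: a ramp just after
    [s] minus one just before [t]. Their derivatives approach the Dirac mass at [s] minus that at
    [t], so continuity of [g] produces [g s - g t], while dominated convergence produces the
    integral of [h]. *)
Lemma weak_derivative_integral (g h : R -> R) :
  (forall t, `[0, T]%classic t -> g r @[r --> within `[0, T] (nbhs t)] --> g t) ->
  mu1.-integrable I0T (EFin \o h) ->
  (forall phi, Cc1_time T phi -> exists c : R,
    [/\ mu1.-integrable I0T (fun r => (derive1 phi r * g r)%:E),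
        (\int[mu1]_(r in I0T) (derive1 phi r * g r)%:E = c%:E)%E &
        (\int[mu1]_(r in I0T) (phi r * h r)%:E = (- c)%:E)%E]) ->
  forall s t, 0 <= s -> s < t -> t <= T ->
  (\int[mu1]_(r in I0T) (\1_(`]s, t]) r * h r)%:E = (g t - g s)%:E)%E.
Proof.
move=> gc ih weak s t s0 st tT.
have T0 : 0 < T by apply: lt_le_trans tT; apply: le_lt_trans st.
have mI : measurable I0T by exact: itv_time_measurable.
(* The factor 4 gives [4 <= m n * (t - s)], which makes the two ramps cancel outside the support
   claimed for [phi n]. *)
pose m n : R := 4 * n.+1%:R / (t - s).
have m0 n : 0 < m n by rewrite divr_gt0 ?mulr_gt0 ?ltr0n ?subr_gt0.
have mst n : 4 <= m n * (t - s).
  by rewrite /m divfK ?subr_eq0 ?gt_eqF// ler_peMr// ler1n.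
have m_large (M x : R) : 0 < x -> \forall n \near \oo, M <= m n * x.
  move=> x0; near=> n; rewrite /m mulrAC ler_pdivlMr ?subr_gt0//.
  rewrite -mulrA mulrCA -ler_pdivrMr; last by rewrite mulr_gt0.
  apply: le_trans (_ : n%:R <= _); last by rewrite ler_nat.
  by near: n; exact: nbhs_infty_ger.
(* These offsets put the rise on $[s+1/m,s+3/m]$ and the fall on $[t-3/m,t-1/m]$; the margins $1/m$
   keep the support inside the open interval even if [s = 0] or [t = T]. *)
pose cs n := - (m n * s + 1); pose ct n := 3 - m n * t.
pose phi n r := ramp (m n * r + cs n) - ramp (m n * r + ct n).
have dphi n : derive1 (phi n) = (fun r => bump (m n) (cs n) r - bump (m n) (ct n) r).
  apply/funext => r; rewrite derive1E.
  have d1 := is_derive_ramp (m n) (cs n) r.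
  have d2 := is_derive_ramp (m n) (ct n) r.
  have d := is_deriveB d1 d2.
  by rewrite (@derive_val _ _ _ _ _ _ _ d).
have cphi n : continuous (phi n).
  by move=> r; apply: cvgB; exact: ramp_continuous.
have phi_test n : Cc1_time T (phi n).
  split.
  - move=> r; apply: derivableB; exact: derivable_ramp.
  - by rewrite dphi => r; apply: cvgB; exact: bump_continuous.
  - exists `[s + (m n)^-1, t - (m n)^-1]%classic; split.
    + exact: segment_compact.
    + move=> r /=; rewrite !in_itv/= => /andP[r1 r2]; apply/andP; split.
        by apply: lt_le_trans r1; rewrite ltr_wpDl// invr_gt0.
      by apply: (le_lt_trans r2); apply: lt_le_trans tT; rewrite gtrBl invr_gt0.
    + move=> r /=; rewrite in_itv/= => /negP; rewrite negb_and -!ltNge => /orP[] h1.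
        have h2 : m n * r < m n * s + 1.
          by rewrite -(ltr_pM2l (m0 n)) mulrDr divff ?gt_eqF// in h1.
        by move: (mst n) h2 => h3 h2; rewrite /phi !ramp0 ?subrr// /cs /ct; move: h2 h3; clear; lra.
      have h2 : m n * t - 1 < m n * r.
        by rewrite -(ltr_pM2l (m0 n)) mulrBr divff ?gt_eqF// in h1.
      by move: (mst n) h2 => h3 h2; rewrite /phi !ramp1 ?subrr// /cs /ct; move: h2 h3; clear; lra.
have ibump n c : mu1.-integrable I0T (EFin \o bump (m n) c).
  apply: measurable_bounded_integrable.
  - exact: mI.
  - exact: mu1_I0T_lty.
  - by apply: measurable_funTS; apply: continuous_time_measurable; exact: bump_continuous.
  - exists (m n); split; first exact: num_real.
    move=> M mM r _ /=; rewrite ger0_norm; last by rewrite bump_ge0// ltW.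
    by apply: le_trans (ltW mM); rewrite ler_piMr ?tent_le1// ltW.
have bs n : (\int[mu1]_(r in I0T) (bump (m n) (cs n) r)%:E = 1)%E.
  apply: bump_integral => //; rewrite /cs.
    by rewrite oppr_le0 addr_ge0// mulr_ge0// ltW.
  have : m n * t <= m n * T by rewrite ler_pM2l.
  by have := mst n; lra.
have bt n : (\int[mu1]_(r in I0T) (bump (m n) (ct n) r)%:E = 1)%E.
  apply: bump_integral => //; rewrite /ct.
    have : 0 <= m n * s by rewrite mulr_ge0// ltW.
    by have := mst n; lra.
  have : m n * t <= m n * T by rewrite ler_pM2l.
  by lra.
have [c cP] : {c : nat -> R & forall n,
    [/\ mu1.-integrable I0T (fun r => (derive1 (phi n) r * g r)%:E),
        (\int[mu1]_(r in I0T) (derive1 (phi n) r * g r)%:E = (c n)%:E)%E &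
        (\int[mu1]_(r in I0T) (phi n r * h r)%:E = (- c n)%:E)%E]}.
  exact: (choice (fun n => weak _ (phi_test n))).
(* Where the bump is nonzero, [r] lies within [4 / m n] of [u], so [g r] is close to [g u];
   elsewhere both sides vanish. *)
have near_bump (b : nat -> R) u : `[0, T]%classic u ->
    (forall n r, 0 <= m n * r + b n <= 2 -> `|m n * u - m n * r| < 4) ->
    forall e, 0 < e -> \forall n \near \oo, forall r, I0T r ->
      bump (m n) (b n) r * `|g r - g u| <= bump (m n) (b n) r * e.
  move=> uI bu e e0; have /cvgrPdist_lt/(_ _ e0) := gc _ uI.
  rewrite near_withinE => /nbhs_ballP[r0 /= r00 r0P].
  apply: filterS (m_large 4 _ r00) => n mn r Ir.
  have [->|br] := eqVneq (bump (m n) (b n) r) 0; first by rewrite !mul0r.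
  apply: ler_wpM2l; first by rewrite bump_ge0// ltW.
  rewrite distrC; apply/ltW/r0P; last exact: subset_itv_oo_cc.
  have : tent (m n * r + b n) != 0 by apply: contraNneq br => h0; rewrite /bump h0 mulr0.
  move=> /tent_supp /bu {}bu; rewrite /ball/= -(ltr_pM2l (m0 n)).
  rewrite -[X in X * `|_|](gtr0_norm (m0 n)) -normrM mulrBr.
  exact: lt_le_trans bu mn.
have sI : `[0, T]%classic s by rewrite /= in_itv/= s0 ltW// (lt_le_trans st).
have tI : `[0, T]%classic t by rewrite /= in_itv/= tT andbT ltW// (le_lt_trans s0).
have near_s := near_bump cs s sI.
have near_t := near_bump ct t tI.
have bump_s n r : 0 <= m n * r + cs n <= 2 -> `|m n * s - m n * r| < 4.
  rewrite /cs ltr_norml; clear => /andP[t1 t2].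
  by apply/andP; split; lra.
have bump_t n r : 0 <= m n * r + ct n <= 2 -> `|m n * t - m n * r| < 4.
  rewrite /ct ltr_norml; clear => /andP[t1 t2].
  by apply/andP; split; lra.
have {}near_s := near_s bump_s; have {}near_t := near_t bump_t.
have lim1 : c n @[n --> \oo] --> g s - g t.
  apply/cvgrPdist_le => e e0; have e20 : 0 < e / 2 by rewrite divr_gt0.
  near=> n; have [ic cE _] := cP n.
  have ns : forall r, I0T r ->
      bump (m n) (cs n) r * `|g r - g s| <= bump (m n) (cs n) r * (e / 2).
    by near: n; exact: near_s.
  have nt : forall r, I0T r ->
      bump (m n) (ct n) r * `|g r - g t| <= bump (m n) (ct n) r * (e / 2).
    by near: n; exact: near_t.
  have iZ c' k : mu1.-integrable I0T (EFin \o (fun r => bump (m n) c' r * k)).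
    exact: (integrableZr mI k (ibump n c')).
  have iB : mu1.-integrable I0T (EFin \o (fun r =>
      bump (m n) (cs n) r * g s - bump (m n) (ct n) r * g t)).
    exact: (integrableB mI (iZ _ _) (iZ _ _)).
  have iD : mu1.-integrable I0T (EFin \o (fun r =>
      bump (m n) (cs n) r * (e / 2) + bump (m n) (ct n) r * (e / 2))).
    exact: (integrableD mI (iZ _ _) (iZ _ _)).
  have RZ c' k : (\int[mu1]_(r in I0T) (bump (m n) c' r)%:E = 1)%E ->
      \int[mu1]_(r in I0T) (bump (m n) c' r * k) = k.
    by move=> b1; rewrite RintegralZr// /Rintegral b1 mul1r.
  have gst : g s - g t = \int[mu1]_(r in I0T)
      (bump (m n) (cs n) r * g s - bump (m n) (ct n) r * g t).
    by rewrite RintegralB ?RZ.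
  have cE' : c n = \int[mu1]_(r in I0T) (derive1 (phi n) r * g r).
    by rewrite /Rintegral cE.
  rewrite distrC gst cE' -RintegralB//.
  have e_int : e = \int[mu1]_(r in I0T)
      (bump (m n) (cs n) r * (e / 2) + bump (m n) (ct n) r * (e / 2)).
    by rewrite RintegralD ?RZ// -splitr.
  rewrite [leRHS]e_int; have iE := integrableB mI ic iB.
  apply: (le_trans (le_normr_Rintegral mI iE)).
  apply: le_Rintegral => //; first exact: (integrable_norm iE).
  move=> r Ir; rewrite dphi.
  have -> : (bump (m n) (cs n) r - bump (m n) (ct n) r) * g r -
      (bump (m n) (cs n) r * g s - bump (m n) (ct n) r * g t) =
      bump (m n) (cs n) r * (g r - g s) - bump (m n) (ct n) r * (g r - g t) by ring.
  have bn c' : `|bump (m n) c' r| = bump (m n) c' r by rewrite ger0_norm// bump_ge0// ltW.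
  apply: (le_trans (ler_normB _ _)); rewrite [X in X + _ <= _]normrM.
  rewrite [X in _ + X <= _]normrM !bn.
  by rewrite lerD ?ns ?nt.
have mh : measurable_fun I0T (h : timeT -> R).
  exact/measurable_EFinP/(measurable_int mu1 ih).
have phi01 n r : `|phi n r| <= 1.
  have /andP[a1 a2] := ramp_bounds (m n * r + cs n).
  have /andP[b1 b2] := ramp_bounds (m n * r + ct n).
  by rewrite /phi ler_norml; move: a1 a2 b1 b2; clear => *; apply/andP; split; lra.
have [_ _ lim2] : [/\ mu1.-integrable I0T (fun r => (\1_(`]s, t]) r * h r)%:E),
    ([sequence \int[mu1]_(r in I0T) `|(phi n r * h r)%:E - (\1_(`]s, t]) r * h r)%:E|]_n
       @ \oo --> 0)%E &
    ([sequence \int[mu1]_(r in I0T) (phi n r * h r)%:E]_n @ \oo -->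
       \int[mu1]_(r in I0T) (\1_(`]s, t]) r * h r)%:E)%E].
  apply: (@dominated_convergence _ _ _ mu1 I0T mI _ _ (fun r => `|h r|%:E)).
  - move=> n; apply/measurable_EFinP/measurable_funM => //.
    by apply: measurable_funTS; exact: continuous_time_measurable.
  - apply/measurable_EFinP/measurable_funM => //.
    by apply: measurable_indic; exact: itv_time_measurable.
  (* At [r = t] every [phi n] vanishes while the indicator is 1, so this point is put in the
     exceptional null set. *)
  - exists [set t]; split.
    + by rewrite -set_itv1; exact: itv_time_measurable.
    + exact: time_measure1.
    + move=> r /=; apply: contra_notP => /eqP rt Ir.
      apply/cvg_EFin; first exact: nearW.
      apply: cvgM; last exact: cvg_cst.
      have [rs|sr] := leP r s.
        rewrite indicE memNset; last by rewrite /= in_itv/= ltNge rs.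
        apply: cvg_near_cst; apply: nearW => n /=.
        have : m n * r <= m n * s by rewrite ler_pM2l.
        by move: (mst n) => h1 h2; rewrite /phi !ramp0 ?subrr// /cs /ct; move: h1 h2; clear; lra.
      have [tr|] := ltP t r.
        rewrite indicE memNset; last by rewrite /= in_itv/= (leNgt r) tr andbF.
        apply: cvg_near_cst; apply: nearW => n /=.
        have : m n * t <= m n * r by rewrite ler_pM2l// ltW.
        by move: (mst n) => h1 h2; rewrite /phi !ramp1 ?subrr// /cs /ct; move: h1 h2; clear; lra.
      rewrite le_eqVlt (negPf rt)/= => {}rt.
      rewrite indicE mem_set; last by rewrite /= in_itv/= sr ltW.
      apply: cvg_near_cst; near=> n.
      have h1 : 3 <= m n * (r - s) by near: n; apply: m_large; rewrite subr_gt0.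
      have h2 : 3 <= m n * (t - r) by near: n; apply: m_large; rewrite subr_gt0.
      by rewrite /phi ramp1 ?ramp0 ?subr0// /cs /ct; move: h1 h2; clear; lra.
  - exact: (integrable_norm ih).
  - apply: aeW => r n _; rewrite lee_fin normrM ler_piMl//; exact: phi01.
have lim3 : (- c n)%:E @[n --> \oo] --> (- (g s - g t))%:E.
  by apply/cvg_EFin; [exact: nearW|exact: cvgN].
have cE : (fun n => \int[mu1]_(r in I0T) (phi n r * h r)%:E)%E = (fun n => (- c n)%:E).
  by apply/funext => n; have [_ _ ->] := cP n.
by rewrite cE in lim2; rewrite -opprB; exact: cvg_unique lim2 lim3.
Unshelve. all: by end_near. Qed.

End weak_derivative.

(** * Work and power of the loading *)

(** The half-open intervals between successive nodes are disjoint and fill the whole interval, so at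
    most one term survives; it tells which frozen set is active at time [r]. *)
Lemma sum_itv_indic {R : realType} (N : nat) (t c : nat -> R) (r : R) :
  (forall i, (i < N)%N -> t i <= t i.+1) ->
  (exists i, [/\ (i < N)%N, t i < r <= t i.+1, t 0%N < r <= t N &
      \sum_(i < N) \1_(`]t i, t i.+1]) r * c i = c i]) \/
  (~~ (t 0%N < r <= t N) /\ \sum_(i < N) \1_(`]t i, t i.+1]) r * c i = 0).
Proof.
elim: N => [|N IH] tN.
  right; rewrite big_ord0; split => //.
  by apply/negP => /andP[h1 h2]; have := lt_le_trans h1 h2; rewrite ltxx.
have t0N : t 0%N <= t N.
  elim: {IH} N tN => // n ih tN; apply: le_trans (tN n _) => //.
  by apply: ih => i /ltnW; exact: tN.
rewrite big_ord_recr/=; have [rN|Nr] := leP r (t N).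
  rewrite [\1__ _]indicE memNset ?mul0r ?addr0; last first.
    by rewrite /= in_itv/= ltNge rN.
  have rN1 : r <= t N.+1 by apply: (le_trans rN); exact: tN.
  have [|[i [iN ri r0N ->]]|[r0N ->]] := IH _.
  - by move=> i /ltnW; exact: tN.
  - left; exists i; split => //; first exact: ltnW.
    by rewrite rN1 andbT; case/andP: r0N.
  - by right; split => //; move: r0N; rewrite rN rN1.
have -> : \sum_(i < N) \1_(`]t i, t i.+1]) r * c i = 0.
  have [|[i [_ _ /andP[_]]]|[_ ->//]] := IH _.
  - by move=> i /ltnW; exact: tN.
  - by rewrite leNgt Nr.
rewrite add0r (le_lt_trans t0N Nr)/=; have [rN1|N1r] := leP r (t N.+1).
  left; exists N; split => //; first by rewrite Nr.
  by rewrite indicE mem_set ?mul1r//= in_itv/= Nr.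
right; split => //; rewrite indicE memNset ?mul0r//= in_itv/= Nr/= leNgt N1r.
by [].
Qed.

Section loading_work.
Context {R : realType} {d : nat}.
Local Notation V := 'rV[R]_d.+1.
Local Notation muV := (@leb R d).
Local Notation mu1 := (@completed_lebesgue_measure R).
Local Notation timeT := (caratheodory_type (mu_ext (wlength (R := R) idfun))).
Variables (Omega : set V) (T : R) (f df : R -> V -> R).
Hypothesis mOmega : measurable (Omega : set (lebT R d)).
Hypothesis fW : W11 Omega T f df.
Hypothesis fC : CL1 Omega T f.
Local Notation I0T := (`]0%R, T[%classic : set timeT).

Definition work (t : R) (Z : set V) : R := pairing muV Omega (f t) Z.
Definition power (t : R) (Z : set V) : R := pairing muV Omega (df t) Z.

Lemma force_L1 t : `[0, T]%classic t -> L1 Omega (f t).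
Proof. by move=> /fC[]. Qed.

Lemma rate_ae_L1 : {ae mu1, forall t : timeT, I0T t -> L1 Omega (df t)}.
Proof. by have [_ [J [iu _ _]] _] := fW. Qed.

Lemma rate_L1norm_integrable : mu1.-integrable I0T (fun t => L1norm Omega (df t)).
Proof. by have [_ [J uJ] _] := fW; exact: bochner_L1norm_integrable uJ. Qed.

Lemma power_integrable Z : measurable (Z : set (lebT R d)) ->
  mu1.-integrable I0T (fun t => (power t Z)%:E).
Proof.
by move=> mZ; have [_ [J uJ] _] := fW; have [] := bochner_pairing mOmega uJ mZ.
Qed.

Lemma power_le_L1norm Z t : measurable (Z : set (lebT R d)) -> L1 Omega (df t) ->
  (`|power t Z|%:E <= L1norm Omega (df t))%E.
Proof. by move=> mZ it; exact: le_norm_pairing. Qed.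

Lemma work_continuous Z t : measurable (Z : set (lebT R d)) -> `[0, T]%classic t ->
  work r Z @[r --> within `[0, T] (nbhs t)] --> work t Z.
Proof.
move=> mZ tI; have [it ct] := fC tI; apply/cvgrPdist_lt => e e0.
have e0' : (nbhs 0%E) [set x : \bar R | (x < e%:E)%E].
  by apply: open_nbhs_nbhs; split; [exact: open_ereal_lt_ereal|rewrite /= lte_fin].
have := ct _ e0'; rewrite /nbhs/= /within/=; apply: filterS => r re rI.
rewrite distrC -lte_fin; apply: le_lt_trans (re rI).
by apply: pairing_dist_le => //; exact: force_L1.
Qed.

(** Pairing the Bochner identity for each test function with the fixed set [Z] leaves the scalar
    weak formulation between its work and its power. *)
Lemma work_increment Z s t : measurable (Z : set (lebT R d)) ->
  0 <= s -> s <= t -> t <= T ->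
  (\int[mu1]_(r in I0T) (\1_(`]s, t]) r * power r Z)%:E =
   (work t Z - work s Z)%:E)%E.
Proof.
move=> mZ s0; rewrite le_eqVlt => /predU1P[-> _|st tT].
  rewrite subrr integral0_eq// => r _.
  by rewrite indicE memNset ?mul0r//= in_itv/=; case: ltP => //; case: ltP.
apply: (@weak_derivative_integral _ T (fun t => work t Z) (fun t => power t Z)) => //.
- by move=> r rI; exact: work_continuous.
- exact: power_integrable.
move=> phi phi_test; have [_ _ wd] := fW.
have [J [fJ dfJ]] := wd _ phi_test.
have [iJ EJ] := bochner_pairing mOmega fJ mZ.
have [_ EJ'] := bochner_pairing mOmega dfJ mZ.
have mI : measurable I0T by exact: itv_time_measurable.
have L1J : L1 Omega J by case: fJ.
have fE r : I0T r -> pairing muV Omega (fun x => derive1 phi r * f r x) Z =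
    derive1 phi r * work r Z.
  by move=> rI; apply: pairingZ => //; apply: force_L1; exact: subset_itv_oo_cc.
exists (pairing muV Omega J Z); split.
- apply: eq_integrable iJ => // r /set_mem rI.
  by rewrite -fE.
- by rewrite -EJ; apply: eq_integral => r /set_mem rI; rewrite fE.
- have -> : - pairing muV Omega J Z = pairing muV Omega (fun x => - J x) Z.
    rewrite -mulN1r -pairingZ//; congr (pairing _ _ _ _).
    by apply/funext => x; rewrite mulN1r.
  rewrite -EJ'.
  have [idJ _] := bochner_pairing mOmega dfJ mZ.
  apply: (@ae_eq_integral _ _ _ mu1 I0T) mI _ _ _.
  - apply/measurable_EFinP/measurable_funM.
    + apply: measurable_funTS; apply: continuous_time_measurable => r.
      have [dphi _ _] := phi_test.
      exact/differentiable_continuous/derivable1_diffP/dphi.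
    + exact/measurable_EFinP/(measurable_int mu1 (power_integrable mZ)).
  - exact: (measurable_int mu1 idJ).
  (* [df r] is in $L^1$ only for almost every [r], so the factor [phi r] leaves the pairing only
     almost everywhere. *)
  - apply: filterS rate_ae_L1 => r ir rI; congr EFin.
    by rewrite [RHS]pairingZ//; exact: ir.
Qed.

Variables (Z : R -> set V) (S S' : R) (N : nat -> nat) (t : nat -> nat -> R)
  (W : nat -> nat -> set V).
Hypothesis SS' : 0 <= S /\ S' <= T.
Hypothesis mZ : forall r, I0T r ->
  measurable (Z r : set (lebT R d)) /\ Z r `<=` Omega.
Hypothesis t0 : forall j, t j 0%N = S.
Hypothesis tN : forall j, t j (N j) = S'.
Hypothesis t_nd : forall j i, (i < N j)%N -> t j i <= t j i.+1.
Hypothesis mW : forall j i, (i < N j)%N ->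
  measurable (W j i : set (lebT R d)) /\ W j i `<=` Omega.
Hypothesis WZ : {ae mu1, forall r : timeT, I0T r -> forall e : R, 0 < e ->
  \forall j \near \oo, forall i, (i < N j)%N -> t j i < r <= t j i.+1 ->
    (muV (W j i `\` Z r) < e%:E)%E /\ (muV (Z r `\` W j i) < e%:E)%E}.

Let H r : R := \1_(`]S, S']) r * power r (Z r).
Let H_ j r : R := \sum_(i < N j) \1_(`]t j i, t j i.+1]) r * power r (W j i).

Let t_mono j i l : (i <= l)%N -> (l <= N j)%N -> t j i <= t j l.
Proof.
elim: l => [|l ih]; first by rewrite leqn0 => /eqP ->.
rewrite leq_eqVlt => /predU1P[-> //|il] lN.
by apply: le_trans (t_nd lN); apply: ih => //; exact: ltnW.
Qed.

Let H_E j r :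
  (exists i, [/\ (i < N j)%N, t j i < r <= t j i.+1, S < r <= S' &
      H_ j r = power r (W j i)]) \/
  (~~ (S < r <= S') /\ H_ j r = 0).
Proof.
have := @sum_itv_indic _ (N j) (t j) (fun i => power r (W j i)) r (@t_nd j).
by rewrite t0 tN.
Qed.

Let H_integrable j : mu1.-integrable I0T (EFin \o H_ j) /\
  (\int[mu1]_(r in I0T) (H_ j r)%:E =
   (\sum_(i < N j) (work (t j i.+1) (W j i) - work (t j i) (W j i)))%:E)%E.
Proof.
have mI : measurable I0T by exact: itv_time_measurable.
have iH (i : 'I_(N j)) : mu1.-integrable I0T
    (fun r => (\1_(`]t j i, t j i.+1]) r * power r (W j i))%:E).
  have [mWi _] := mW (ltn_ord i).
  apply: (le_integrable mI _ _ (power_integrable mWi)).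
    apply/measurable_EFinP/measurable_funM.
      by apply: measurable_indic; exact: itv_time_measurable.
    exact/measurable_EFinP/(measurable_int mu1 (power_integrable mWi)).
  move=> r _; rewrite lee_fin normrM ler_piMl// indicE.
  by case: (_ \in _); rewrite ?normr1 ?normr0.
have E : EFin \o H_ j = fun r => (\sum_(i < N j)
    (\1_(`]t j i, t j i.+1]) r * power r (W j i))%:E)%E.
  by apply/funext => r; rewrite /= sumEFin.
split; first by rewrite E; exact: (integrable_sum mI).
rewrite -[LHS]/(\int[mu1]_(r in I0T) (EFin \o H_ j) r)%E E.
rewrite (integral_sum mI iH) -sumEFin; apply: eq_bigr => i _.
have [mWi _] := mW (ltn_ord i).
apply: work_increment => //.
- by rewrite (le_trans SS'.1)// -(t0 j) t_mono// ltnW.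
- exact: t_nd.
- by rewrite (le_trans _ SS'.2)// -(tN j) t_mono.
Qed.

(** With [W j i] frozen on its interval, the sum of work increments is the integral of the step
    function [H_ j]. Almost everywhere [H_ j] tends to [H], by absolute continuity of the integral
    of [df r], and the norm of [df r] dominates. The measurability of [H] comes from the same
    limit. *)
Lemma step_power_cvg :
  mu1.-integrable I0T (EFin \o H) /\
  \sum_(i < N j) (work (t j i.+1) (W j i) - work (t j i) (W j i)) @[j --> \oo]
    --> \int[mu1]_(r in I0T) H r.
Proof.
have mI : measurable I0T by exact: itv_time_measurable.
have HH : {ae mu1, forall r : timeT, I0T r -> (H_ j r)%:E @[j --> \oo] --> (H r)%:E}.
  apply: filterS2 rate_ae_L1 WZ => r ir WZr rI.
  apply/cvg_EFin; first exact: nearW.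
  apply/cvgrPdist_lt => e e0.
  have [mZr ZrO] := mZ rI.
  have [q q0 qP] := pairing_abs_cont mOmega (ir rI) e0.
  apply: filterS (WZr rI _ q0) => j jP /=.
  have [[i [iN ti rS ->]]|[rS ->]] := H_E j r.
    rewrite /H indicE mem_set ?mul1r; last by rewrite /= in_itv.
    have [q1 q2] := jP _ iN ti; have [mWi WiO] := mW iN.
    exact: qP.
  rewrite /H indicE memNset ?mul0r ?subrr ?normr0//.
  by rewrite /= in_itv; apply/negP.
have mH_ j : measurable_fun I0T (fun r : timeT => (H_ j r)%:E).
  by have [iH _] := H_integrable j; exact: (measurable_int mu1 iH).
have mH : measurable_fun I0T (fun r : timeT => (H r)%:E).
  apply: (@ae_cvg_measurable _ _ _ mu1 _ (fun j r => (H_ j r)%:E)) => //.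
  exact: completed_lebesgue_measure_is_complete.
have domH : {ae mu1, forall (r : timeT) j, I0T r ->
    (`|(H_ j r)%:E| <= L1norm Omega (df r))%E}.
  apply: filterS rate_ae_L1 => r ir j rI.
  have [[i [iN ti rS ->]]|[rS ->]] := H_E j r.
    apply: power_le_L1norm; last exact: ir.
    by have [] := mW iN.
  by rewrite abse0; exact: L1norm_ge0.
have [iH _ cH] := dominated_convergence mI mH_ mH HH rate_L1norm_integrable domH.
split=> //; move: cH.
rewrite -[X in _ --> X -> _]fineK; last exact: (integrable_fin_num mI iH).
move=> /fine_cvgP[_]; apply: cvg_trans; apply: near_eq_cvg; apply: nearW => j /=.
by have [_ ->] := H_integrable j.
Qed.

End loading_work.

(** * Inclusion up to null sets and decreasing families of sets *)

Section ae_sets.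
Context {R : realType} {d : nat}.
Local Notation V := 'rV[R]_d.+1.
Local Notation muV := (@leb R d).
Implicit Types A B C : set V.

Lemma ae_subsetP A B : measurable (A : set (lebT R d)) ->
  measurable (B : set (lebT R d)) -> ae_subset A B <-> muV (A `\` B) = 0%E.
Proof.
move=> mA mB.
have mAB : measurable (A `\` B : set (lebT R d)) by exact: measurableD.
rewrite -(negligibleP muV mAB); split; apply: negligibleS.
  by move=> x [Ax Bx] /= /(_ Ax).
by move=> x /= /not_implyP.
Qed.

Lemma ae_subset_trans A B C : ae_subset A B -> ae_subset B C -> ae_subset A C.
Proof.
move=> AB BC; have F := @ae_filter_ringOfSetsType _ (lebT R d) R muV.
by apply: (@filterS2 _ _ F _ _ _ _ AB BC) => x {}AB {}BC /AB /BC.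
Qed.

Definition excess A B : R := fine (muV (A `\` B)).

End ae_sets.

Section monotone_family.
Context {R : realType} {d : nat}.
Local Notation V := 'rV[R]_d.+1.
Local Notation muV := (@leb R d).
Local Notation mu1 := (@completed_lebesgue_measure R).
Local Notation timeT := (caratheodory_type (mu_ext (wlength (R := R) idfun))).
Variables (Omega : set V) (T : R) (Z : R -> set V).
Hypothesis mOmega : measurable (Omega : set (lebT R d)).
Hypothesis Omega_fin : (muV Omega < +oo)%E.
Local Notation I0T := (`]0%R, T[%classic : set timeT).

Lemma Zsets_fin_num A : Zsets Omega A -> muV A \is a fin_num.
Proof.
move=> [mA AO]; rewrite ge0_fin_numE//; apply: le_lt_trans Omega_fin.
by apply: le_measure; rewrite ?inE.
Qed.

Lemma excess_fin_num A B : Zsets Omega A -> Zsets Omega B ->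
  muV (A `\` B) \is a fin_num.
Proof.
move=> [mA AO] [mB BO]; apply: Zsets_fin_num; split; first exact: measurableD.
by move=> x [/AO].
Qed.

Lemma EFin_excess A B : Zsets Omega A -> Zsets Omega B ->
  muV (A `\` B) = (excess A B)%:E.
Proof. by move=> ZA ZB; rewrite fineK//; exact: excess_fin_num. Qed.

(** On nested sets the excess is a difference of measures; this is what makes dissipation telescope
    along a decreasing curve. *)
Lemma excess_subset A B : Zsets Omega A -> Zsets Omega B -> ae_subset B A ->
  excess A B = fine (muV A) - fine (muV B).
Proof.
move=> ZA ZB; have fA := Zsets_fin_num ZA; have fB := Zsets_fin_num ZB.
case: (ZA) (ZB) => mA _ [mB _] /(ae_subsetP mB mA) BA.
have DA : (muV A = muV (A `\` B) + muV (A `&` B))%E by exact: measureDI.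
have DB : (muV B = muV (B `\` A) + muV (B `&` A))%E by exact: measureDI.
rewrite BA add0e setIC in DB.
by rewrite DA -DB fineD ?excess_fin_num// addrK.
Qed.

Hypothesis ZZ : forall t, `[0, T]%classic t -> Zsets Omega (Z t).
Hypothesis Znd : forall s t, 0 <= s -> s <= t -> t <= T -> ae_subset (Z t) (Z s).

(** The measure of [Z r] is monotone in [r], so its one-sided limits agree outside a countable set.
    There the drop of measure from [r - q] to [r + q] is small, and it bounds the difference of any
    two sets of the family taken between these times. *)
Lemma monotone_family_ae_continuous :
  {ae mu1, forall r : timeT, I0T r -> forall e : R, 0 < e ->
    exists2 q : R, 0 < q & [/\ 0 <= r - q, r + q <= T &
      (muV (Z (r - q) `\` Z (r + q)) < e%:E)%E]}.
Proof.
pose F r : R := - fine (muV (Z r)).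
have Fnd : {in `[0, T] &, nondecreasing_fun F}.
  move=> s t sI tI st; rewrite lerN2 -subr_ge0.
  have [/andP[s0 sT] /andP[t0 tT]] := (sI, tI).
  rewrite -excess_subset; [|exact: ZZ|exact: ZZ|exact: Znd].
  by rewrite fine_ge0.
have cD := discontinuity_countable Fnd.
exists [set x | x \in (`]0, T[) /\ discontinuity F x]; split.
- by apply: borel_time_measurable; apply: countable_measurable.
- exact: countable_lebesgue_measure0.
move=> r /=; apply: contra_notP => nd rI.
have r0T := rI; rewrite /= in_itv/= in r0T; case/andP: r0T => r0 rT.
have cl : cvg (F x @[x --> r^'-]).
  apply: nondecreasing_at_left_is_cvgr.
    near=> x; have x0 : 0 <= x by near: x; exact: nbhs_left_ge.
    move=> s t /[!in_itv]/= /andP[xs sr] /andP[xt tr]; apply: Fnd.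
    - by rewrite in_itv/=; apply/andP; split; lra.
    - by rewrite in_itv/=; apply/andP; split; lra.
  near=> x; have x0 : 0 <= x by near: x; exact: nbhs_left_ge.
  exists (F T) => _ [s /= /[!in_itv]/= /andP[xs sr] <-]; apply: Fnd.
  - by rewrite in_itv/=; apply/andP; split; lra.
  - by rewrite in_itv/=; apply/andP; split; lra.
  - by lra.
have cr : cvg (F x @[x --> r^'+]).
  apply: nondecreasing_at_right_is_cvgr.
    near=> x; have xT : x <= T by near: x; exact: nbhs_right_le.
    move=> s t /[!in_itv]/= /andP[xs sr] /andP[xt tr]; apply: Fnd.
    - by rewrite in_itv/=; apply/andP; split; lra.
    - by rewrite in_itv/=; apply/andP; split; lra.
  near=> x; have xT : x <= T by near: x; exact: nbhs_right_le.
  exists (F 0) => _ [s /= /[!in_itv]/= /andP[xs sr] <-]; apply: Fnd.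
  - by rewrite in_itv/=; apply/andP; split; lra.
  - by rewrite in_itv/=; apply/andP; split; lra.
  - by lra.
have lr : lim (F x @[x --> r^'-]) = lim (F x @[x --> r^'+]).
  by apply/eqP; apply: contra_notT nd => nd; split.
move=> e e0; have e20 : 0 < e / 2 by rewrite divr_gt0.
move/cvg_ex: cl => [l cl]; move/cvg_ex: cr => [l' cr].
have ll' : l = l' by move: lr; rewrite (cvg_lim _ cl)// (cvg_lim _ cr).
subst l'.
have /cvgrPdist_lt/(_ _ e20) nl := cl; have /cvgrPdist_lt/(_ _ e20) nr := cr.
move/nbhs_left0P in nl; move/nbhs_right0P in nr.
have r0' : \forall x \near r^'-, 0 <= x by exact: nbhs_left_ge.
have rT' : \forall x \near r^'+, x <= T by exact: nbhs_right_le.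
move/nbhs_left0P in r0'; move/nbhs_right0P in rT'.
near (0 : R)^'+ => q; have q0 : 0 < q by near: q; exact: nbhs_right_gt.
have h1 : 0 <= r - q by near: q.
have h2 : r + q <= T by near: q.
have h3 : `|l - F (r - q)| < e / 2 by near: q.
have h4 : `|l - F (r + q)| < e / 2 by near: q.
exists q => //; split => //.
have I1 : `[0, T]%classic (r - q) by rewrite /= in_itv/=; apply/andP; split; lra.
have I2 : `[0, T]%classic (r + q) by rewrite /= in_itv/=; apply/andP; split; lra.
rewrite (EFin_excess (ZZ I1) (ZZ I2)) lte_fin (excess_subset (ZZ I1) (ZZ I2)); last first.
  by apply: Znd; lra.
have -> : fine (muV (Z (r - q))) - fine (muV (Z (r + q))) = F (r + q) - F (r - q).
  by rewrite /F opprK addrC.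
move: h3 h4; rewrite !ltr_norml; clear => /andP[a1 a2] /andP[b1 b2]; lra.
Unshelve. all: by end_near. Qed.

End monotone_family.

(** * The lower energy estimate *)

Section energetics.
Context {R : realType} {d : nat}.
Local Notation V := 'rV[R]_d.+1.
Local Notation muV := (@leb R d).
Local Notation mu1 := (@completed_lebesgue_measure R).
Local Notation timeT := (caratheodory_type (mu_ext (wlength (R := R) idfun))).
Variables (Omega : set V) (T a : R) (k : nat) (f df : R -> V -> R).
Hypothesis mOmega : measurable (Omega : set (lebT R d)).
Hypothesis Omega_fin : (muV Omega < +oo)%E.
Hypothesis fW : W11 Omega T f df.
Hypothesis fC : CL1 Omega T f.
Local Notation I0T := (`]0%R, T[%classic : set timeT).

Definition rperimeter (Z : set V) : R := fine (perimeter Omega Z).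

(** The zero field is admissible in the supremum. *)
Lemma perimeter_ge0 Z : (0 <= perimeter Omega Z)%E.
Proof.
apply: ereal_sup_ubound; exists (fun=> 0).
  split; last by move=> x; rewrite /enorm /dot big1 ?sqrtr0 ?ler01// => i _; rewrite mxE mul0r.
  move=> i; have -> : (fun _ : V => (0 : V) ord0 i) = cst 0.
    by apply/funext => x; rewrite mxE.
  split.
    move=> j; split=> [x|]; first exact: derivable_cst.
    have -> : partial j (cst 0 : V -> R) = cst 0.
      by apply/funext => x; rewrite /partial derive_cst.
    exact: cst_continuous.
  by exists set0; split => //; exact: compact0.
rewrite integral0_eq// => x _; rewrite (_ : divergence _ _ = 0) ?mulr0//.
rewrite /divergence big1// => i _.
have -> : (fun _ : V => (0 : V) ord0 i) = cst 0.
  by apply/funext => y; rewrite mxE.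
by rewrite /partial derive_cst.
Qed.

Lemma EFin_rperimeter Z : Xsets Omega Z -> perimeter Omega Z = (rperimeter Z)%:E.
Proof. by move=> [_ Zoo]; rewrite fineK// ge0_fin_numE// perimeter_ge0. Qed.

Lemma force_pairing (g : V -> R) Z : L1 Omega g -> Zsets Omega Z ->
  (\int[muV]_(x in Omega) (k%:R * g x * \1_Z x)%:E =
  (k%:R * pairing muV Omega g Z)%:E)%E.
Proof.
move=> ig [mZ _]; rewrite -pairingZ// -EFin_pairing//.
exact: (L1_scale mOmega k%:R ig).
Qed.

Definition renergy t Z := rperimeter Z + k%:R * work Omega f t Z.

Lemma energyE t Z : `[0, T]%classic t -> Xsets Omega Z ->
  energy Omega k f t Z = (renergy t Z)%:E.
Proof.
move=> tI XZ; rewrite /energy EFin_rperimeter// force_pairing//; first exact: (force_L1 fC tI).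
by case: XZ.
Qed.

Lemma dissipationE A B : Zsets Omega A -> Zsets Omega B -> ae_subset B A ->
  dissipation a A B = (a * excess A B)%:E.
Proof.
move=> ZA ZB BA; rewrite /dissipation; case: asboolP => // _.
by rewrite EFinM -(EFin_excess mOmega Omega_fin ZA ZB).
Qed.

Lemma excess_ae_mono A A' B B' : Zsets Omega A -> Zsets Omega A' ->
  Zsets Omega B -> Zsets Omega B' -> ae_subset A A' -> ae_subset B' B ->
  (muV (A `\` B) <= muV (A' `\` B'))%E.
Proof.
move=> [mA _] [mA' _] [mB _] [mB' _] /(ae_subsetP mA mA') AA' /(ae_subsetP mB' mB) BB'.
have h1 : (muV (A `\` B) <= muV (A `\` A') + muV (A' `\` B))%E.
  exact: measureD_triangle.
have h2 : (muV (A' `\` B) <= muV (A' `\` B') + muV (B' `\` B))%E.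
  exact: measureD_triangle.
by rewrite AA' add0e in h1; rewrite BB' adde0 in h2; exact: le_trans h1 h2.
Qed.

Section stable_curve.
Variable Z : R -> set V.
Hypothesis ZX : forall t, `[0, T]%classic t -> Xsets Omega (Z t).
Hypothesis Znd : forall s t, 0 <= s -> s <= t -> t <= T -> ae_subset (Z t) (Z s).
Hypothesis Zstable : forall t, `[0, T]%classic t -> stable Omega a k f t (Z t).

Let ZZ t (tI : `[0, T]%classic t) : Zsets Omega (Z t) := (ZX tI).1.

(** Stability at time [s] with competitor [Z t]. The energy of [Z t] at time [s] differs from that
    at time [t] by its work increment alone, since the perimeter does not see time. *)
Lemma stable_increment s t : 0 <= s -> s <= t -> t <= T ->
  renergy s (Z s) <= renergy t (Z t) + a * (fine (muV (Z s)) - fine (muV (Z t))) -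
    k%:R * (work Omega f t (Z t) - work Omega f s (Z t)).
Proof.
move=> s0 st tT.
have sI : `[0, T]%classic s by rewrite /= in_itv/= s0 (le_trans st).
have tI : `[0, T]%classic t by rewrite /= in_itv/= tT (le_trans s0).
have := Zstable sI (ZZ tI).
rewrite (energyE sI (ZX sI)) (energyE sI (ZX tI)).
rewrite (dissipationE (ZZ sI) (ZZ tI) (Znd s0 st tT)) lee_fin.
rewrite (excess_subset mOmega Omega_fin (ZZ sI) (ZZ tI) (Znd s0 st tT)) /renergy.
by lra.
Qed.

Lemma stable_lower_bound s t : 0 <= s -> s <= t -> t <= T ->
  mu1.-integrable I0T (fun r => (\1_(`]s, t]) r * power Omega df r (Z r))%:E) /\
  renergy s (Z s) <= renergy t (Z t) + a * (fine (muV (Z s)) - fine (muV (Z t))) -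
    k%:R * \int[mu1]_(r in I0T) (\1_(`]s, t]) r * power Omega df r (Z r)).
Proof.
move=> s0 st tT.
pose tt (j i : nat) : R := s + (t - s) * (i%:R / j.+1%:R).
pose N (j : nat) := j.+1.
pose W (j i : nat) := Z (tt j i.+1).
have tt0 j : tt j 0%N = s by rewrite /tt mul0r mulr0 addr0.
have ttN j : tt j (N j) = t by rewrite /tt divff ?pnatr_eq0// mulr1 subrKC.
have tt_nd j i l : (i <= l)%N -> tt j i <= tt j l.
  move=> il; rewrite /tt lerD2l ler_wpM2l ?subr_ge0// ler_wpM2r ?invr_ge0//.
  by rewrite ler_nat.
have ttI j i : (i <= N j)%N -> `[0, T]%classic (tt j i).
  move=> iN; rewrite /= in_itv/=; apply/andP; split.
    by rewrite (le_trans s0)// -(tt0 j) tt_nd.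
  by rewrite (le_trans _ tT)// -(ttN j) tt_nd.
have [iH cH] : mu1.-integrable I0T (EFin \o (fun r => \1_(`]s, t]) r * power Omega df r (Z r))) /\
  \sum_(i < N j) (work Omega f (tt j i.+1) (W j i) - work Omega f (tt j i) (W j i)) @[j --> \oo]
    --> \int[mu1]_(r in I0T) (\1_(`]s, t]) r * power Omega df r (Z r)).
  apply: (step_power_cvg mOmega fW fC (conj s0 tT)) => //.
  - move=> r rI; have rI' : `[0, T]%classic r by exact: subset_itv_oo_cc.
    exact: (ZZ rI').
  - by move=> j i _; exact: tt_nd.
  - by move=> j i iN; exact: (ZZ (ttI _ _ iN)).
  apply: filterS (monotone_family_ae_continuous mOmega Omega_fin ZZ Znd).
  move=> r rP rI e e0; have [q q0 [rq0 rqT Zq]] := rP rI e e0.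
  near=> j => i iN /andP[tir rti].
  have rI' : `[0, T]%classic r by exact: subset_itv_oo_cc.
  have r0T := rI'; rewrite /= in_itv/= in r0T; case/andP: r0T => r0 rT.
  have tI := ttI _ _ iN; have tT' := tI; rewrite /= in_itv/= in tT'; case/andP: tT' => _ tT'.
  have step : tt j i.+1 <= r + q.
    have -> : tt j i.+1 = tt j i + (t - s) / j.+1%:R.
      by rewrite /tt -addrA; congr (_ + _); rewrite -[i.+1%:R]natr1 [(_ + 1) / _]mulrDl mulrDr mul1r.
    apply: lerD; first exact: ltW.
    rewrite ler_pdivrMr// -ler_pdivrMl//.
    apply: (@le_trans _ _ j%:R); last by rewrite ler_nat.
    by near: j; exact: nbhs_infty_ger.
  have qI1 : `[0, T]%classic (r - q) by rewrite /= in_itv/= rq0/= (le_trans _ rT)// gerBl ltW.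
  have qI2 : `[0, T]%classic (r + q) by rewrite /= in_itv/= rqT andbT addr_ge0// ltW.
  (* The node ending the interval comes after [r], so its set lies in [Z r] and the first excess is
     zero; it comes before [r + q], so the second is bounded by the drop from [r - q] to [r + q]. *)
  split.
    apply: le_lt_trans (excess_ae_mono (ZZ tI) (ZZ rI') (ZZ rI') (ZZ rI') _ _) _.
    - exact: Znd.
    - exact: Znd.
    - by rewrite setDv measure0 lte_fin.
  apply: le_lt_trans (excess_ae_mono (ZZ rI') (ZZ qI1) (ZZ tI) (ZZ qI2) _ _) Zq.
  - by apply: Znd => //; rewrite gerBl ltW.
  - by apply: Znd => //; exact: le_trans r0 rti.
split=> //.
(* Energies and measures at the intermediate nodes telescope; only the work increments
   accumulate. *)
have step j n : (n <= N j)%N -> renergy s (Z s) <=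
    renergy (tt j n) (Z (tt j n)) + a * (fine (muV (Z s)) - fine (muV (Z (tt j n)))) -
    k%:R * \sum_(i < n) (work Omega f (tt j i.+1) (W j i) - work Omega f (tt j i) (W j i)).
  elim: n => [_|n ih nN].
    by rewrite big_ord0 mulr0 subr0 tt0 subrr mulr0 addr0.
  apply: (le_trans (ih (ltnW nN))); rewrite big_ord_recr/=.
  have I1 := ttI _ _ (ltnW nN); have I2 := ttI _ _ nN.
  have := @stable_increment (tt j n) (tt j n.+1).
  rewrite /= in_itv/= in I1; rewrite /= in_itv/= in I2.
  case/andP: I1 => I1 _; case/andP: I2 => _ I2.
  move=> /(_ I1 (tt_nd _ _ _ (leqnSn n)) I2).
  rewrite -[Z (tt j n.+1)]/(W j n); move: (\sum_(i < n) _) => C.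
  move: (work _ _ _ _) (work _ _ _ _) => w w'.
  move: (renergy _ _) (renergy _ _) (fine _) (fine _) (fine _) => *; lra.
have lim1 : (fun j => renergy t (Z t) + a * (fine (muV (Z s)) - fine (muV (Z t))) -
    k%:R * \sum_(i < N j) (work Omega f (tt j i.+1) (W j i) - work Omega f (tt j i) (W j i)))
    @ \oo --> renergy t (Z t) + a * (fine (muV (Z s)) - fine (muV (Z t))) -
    k%:R * \int[mu1]_(r in I0T) (\1_(`]s, t]) r * power Omega df r (Z r)).
  by apply: cvgB; [exact: cvg_cst|apply: cvgM => //; exact: cvg_cst].
apply: (cvgr_to_ge lim1); apply: nearW => j.
by have := step j _ (leqnn _); rewrite ttN.
Unshelve. all: by end_near. Qed.

End stable_curve.

End energetics.

(** * Convergence of sets and lower semicontinuity of the perimeter *)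

Section set_convergence.
Context {R : realType} {d : nat}.
Local Notation V := 'rV[R]_d.+1.
Local Notation muV := (@leb R d).
Variable Omega : set V.
Hypothesis mOmega : measurable (Omega : set (lebT R d)).
Hypothesis Omega_bounded : bounded_set Omega.

Let Omega_fin : (muV Omega < +oo)%E := bounded_leb_lty Omega_bounded.

(** A bounded [Omega] has finite measure and lies in a compact cube, on which [g] is bounded. *)
Lemma continuous_L1 (g : V -> R) : continuous g -> L1 Omega g.
Proof.
move=> cg; apply: measurable_bounded_integrable => //.
  by apply: measurable_funTS; exact: continuous_leb_measurable.
have [M [_ /(_ (M + 1))]] := Omega_bounded; rewrite ltrDl ltr01 => /(_ isT) OM.
have cK : compact [set v : V | forall i, `[- (M + 1), M + 1]%classic (v ord0 i)].
  apply: (@rV_compact _ _ (fun=> `[(- (M + 1)), (M + 1)]%classic)) => _.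
  exact: segment_compact.
have [B [Br BP]] : bounded_set (g @` [set v : V | forall i, `[- (M + 1), M + 1]%classic (v ord0 i)]).
  by apply: compact_bounded; apply: continuous_compact cK; exact: continuous_subspaceT.
exists B; split => // M' BM' x Ox; apply: (BP _ BM'); exists x => // i /=.
rewrite in_itv/= -ler_norml; apply: le_trans (OM _ Ox).
by rewrite [leRHS]/Num.norm/= mx_normrE; exact: le_bigmax (ord0, i).
Qed.

Lemma divergence_L1 phi : Cc1_field Omega phi -> L1 Omega (divergence phi).
Proof.
move=> cphi; have := @L1_sum _ _ _ mOmega _ (index_enum 'I_d.+1) (fun=> 1)
  (fun i => partial i (fun y => phi y ord0 i)).
under eq_fun do under eq_bigr do rewrite mul1r.
by apply=> i; apply: continuous_L1; have [/(_ i)[]] := cphi i.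
Qed.

(** For measurable subsets of [Omega] this is $L^1$ convergence of the indicators. The two halves of
    the symmetric difference are kept apart because inclusions control them separately. *)
Definition set_cvg (A_ : nat -> set V) (A : set V) :=
  forall e : R, 0 < e -> \forall j \near \oo,
    (muV (A_ j `\` A) < e%:E)%E /\ (muV (A `\` A_ j) < e%:E)%E.

Lemma set_cvg_pairing w A_ A : L1 Omega w -> (forall j, Zsets Omega (A_ j)) ->
  Zsets Omega A -> set_cvg A_ A ->
  pairing muV Omega w (A_ j) @[j --> \oo] --> pairing muV Omega w A.
Proof.
move=> iw ZA_ [mA AO] cA; apply/cvgrPdist_lt => e e0.
have [q q0 qP] := pairing_abs_cont mOmega iw e0.
apply: filterS (cA _ q0) => j [h1 h2]; have [mAj AjO] := ZA_ j.
exact: qP.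
Qed.

Lemma BV_cvg_set_cvg A_ A : (forall j, Zsets Omega (A_ j)) -> Zsets Omega A ->
  BV_weak_star_cvg Omega (fun j => \1_(A_ j)) \1_A -> set_cvg A_ A.
Proof.
move=> ZA_ [mA AO] [_ _ cA _] e e0.
apply: filterS (cvge0_lt cA e0) => j dj; have [mAj AjO] := ZA_ j.
split; apply: le_lt_trans dj.
  exact: (measureD_le_indic muV mOmega).
apply: (le_trans (measureD_le_indic muV mOmega mA mAj AO)).
by rewrite le_eqVlt; apply/orP; left; apply/eqP/eq_integral => x _; rewrite distrC.
Qed.

(** Writing the measure as a pairing with the constant 1 lets continuity and invariance results for
    pairings apply to it. *)
Lemma measure_pairing A : Zsets Omega A ->
  fine (muV A) = pairing muV Omega (fun=> 1) A.
Proof.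
move=> [mA AO]; rewrite pairingE// Rintegral_cst// mul1r.
by [].
Qed.

Lemma set_cvg_measure A_ A : (forall j, Zsets Omega (A_ j)) -> Zsets Omega A ->
  set_cvg A_ A -> fine (muV (A_ j)) @[j --> \oo] --> fine (muV A).
Proof.
move=> ZA_ ZA cA; rewrite measure_pairing//.
under eq_fun do rewrite measure_pairing//.
by apply: set_cvg_pairing => //; apply: continuous_L1; exact: cst_continuous.
Qed.

(** $A\setminus B$ is covered by $A\setminus A_j$, $A_j\setminus B_j$ and $B_j\setminus B$; the
    middle set is null and the other two have vanishing measure. *)
Lemma set_cvg_ae_subset A_ A B_ B : (forall j, Zsets Omega (A_ j)) ->
  Zsets Omega A -> (forall j, Zsets Omega (B_ j)) -> Zsets Omega B ->
  set_cvg A_ A -> set_cvg B_ B -> (forall j, ae_subset (A_ j) (B_ j)) ->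
  ae_subset A B.
Proof.
move=> ZA_ ZA ZB_ ZB cA cB AB; have [[mA _] [mB _]] := (ZA, ZB).
apply/ae_subsetP => //; apply/eqP; rewrite -measure_le0.
apply/lee_addgt0Pr => e e0; have e20 : 0 < e / 2 by rewrite divr_gt0.
near \oo => j.
have [_ h1] : (muV (A_ j `\` A) < (e / 2)%:E)%E /\ (muV (A `\` A_ j) < (e / 2)%:E)%E.
  by near: j; exact: cA.
have [h2 _] : (muV (B_ j `\` B) < (e / 2)%:E)%E /\ (muV (B `\` B_ j) < (e / 2)%:E)%E.
  by near: j; exact: cB.
have [[mAj _] [mBj _]] := (ZA_ j, ZB_ j).
have t1 : (muV (A `\` B) <= muV (A `\` A_ j) + muV (A_ j `\` B))%E.
  exact: measureD_triangle.
have t2 : (muV (A_ j `\` B) <= muV (A_ j `\` B_ j) + muV (B_ j `\` B))%E.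
  exact: measureD_triangle.
have /(ae_subsetP mAj mBj) t3 := AB j; rewrite t3 add0e in t2.
rewrite add0e; apply: (le_trans t1); rewrite [e]splitr EFinD.
by apply: leeD; [exact: ltW|apply: (le_trans t2); exact: ltW].
Unshelve. all: by end_near. Qed.

Definition test_field (phi : V -> V) :=
  Cc1_field Omega phi /\ forall x, enorm (phi x) <= 1.

Lemma EFin_div_pairing phi Z : test_field phi -> Zsets Omega Z ->
  (\int[muV]_(x in Omega) (\1_Z x * divergence phi x)%:E =
  (pairing muV Omega (divergence phi) Z)%:E)%E.
Proof.
move=> [cphi _] [mZ _]; rewrite -(EFin_pairing mOmega mZ (divergence_L1 cphi)).
by apply: eq_integral => x _; rewrite mulrC.
Qed.

Lemma perimeter_le Z (X : R) : Zsets Omega Z ->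
  (forall phi, test_field phi -> pairing muV Omega (divergence phi) Z <= X) ->
  (perimeter Omega Z <= X%:E)%E.
Proof.
move=> ZZ ZX; apply: ge_ereal_sup => _ [phi tphi <-].
by rewrite (EFin_div_pairing tphi ZZ) lee_fin ZX.
Qed.

Lemma pairing_le_per phi Z : test_field phi -> Xsets Omega Z ->
  pairing muV Omega (divergence phi) Z <= rperimeter Omega Z.
Proof.
move=> tphi XZ; rewrite -lee_fin -(EFin_rperimeter XZ) -(EFin_div_pairing tphi XZ.1).
by apply: ereal_sup_ubound; exists phi.
Qed.

(** For each test field the pairing with its divergence is continuous along [set_cvg], and the
    perimeter is the supremum of these pairings. Convergent upper bounds [X_] replace the lower
    limit because that is what the discrete estimate supplies. *)
Lemma per_lsc A_ A (X_ : nat -> R) X : (forall j, Xsets Omega (A_ j)) ->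
  Xsets Omega A -> set_cvg A_ A ->
  (forall j, rperimeter Omega (A_ j) <= X_ j) -> X_ j @[j --> \oo] --> X ->
  rperimeter Omega A <= X.
Proof.
move=> XA_ XA cA AX cX; rewrite -lee_fin -(EFin_rperimeter XA).
apply: perimeter_le => [|phi tphi]; first exact: XA.1.
have cp : pairing muV Omega (divergence phi) (A_ j) @[j --> \oo] -->
    pairing muV Omega (divergence phi) A.
  apply: set_cvg_pairing => //; [exact/divergence_L1/tphi.1| |exact: XA.1].
  by move=> j; exact: (XA_ j).1.
apply: (ler_cvg_to cp cX); apply: nearW => j.
exact: le_trans (pairing_le_per tphi (XA_ j)) (AX j).
Qed.

Lemma ae_eq_pairing w A B : L1 Omega w -> Zsets Omega A -> Zsets Omega B ->
  ae_eq_set A B -> pairing muV Omega w A = pairing muV Omega w B.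
Proof.
move=> iw [mA AO] [mB BO] [AB BA].
by apply: (eq_pairing mOmega iw) => //; apply/ae_subsetP.
Qed.

(** The perimeter sees a set only through integrals. This matters at time 0, where the discrete set
    and [Z 0] are equal only almost everywhere. *)
Lemma ae_eq_per A B : Xsets Omega A -> Xsets Omega B ->
  ae_eq_set A B -> rperimeter Omega A = rperimeter Omega B.
Proof.
have wlog_le C D : Xsets Omega C -> Xsets Omega D -> ae_eq_set C D ->
    rperimeter Omega C <= rperimeter Omega D.
  move=> XC XD CD; rewrite -lee_fin -(EFin_rperimeter XC).
  apply: perimeter_le => [|phi tphi]; first exact: XC.1.
  rewrite (ae_eq_pairing (divergence_L1 tphi.1) XC.1 XD.1 CD).
  exact: pairing_le_per.
move=> XA XB AB; apply/eqP; rewrite eq_le !wlog_le//.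
by case: AB.
Qed.

Lemma ae_eq_measure A B : Zsets Omega A -> Zsets Omega B ->
  ae_eq_set A B -> fine (muV A) = fine (muV B).
Proof.
move=> ZA ZB AB; rewrite !measure_pairing//; apply: ae_eq_pairing => //.
by apply: continuous_L1; exact: cst_continuous.
Qed.

End set_convergence.

(** * The upper energy estimate *)

Section partitions.
Context {R : realType}.
Variables (T : R) (N : nat) (t : nat -> R).
Hypothesis tP : is_partition T N t.

Lemma partition_lt i l : (i < l)%N -> (l <= N)%N -> t i < t l.
Proof.
have [_ _ tS] := tP; elim: l => // l ih.
rewrite ltnS leq_eqVlt => /predU1P[->|il] lN; first exact: tS.
by apply: lt_trans (tS _ lN); apply: ih => //; exact: ltnW.
Qed.

Lemma partition_le i l : (i <= l)%N -> (l <= N)%N -> t i <= t l.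
Proof.
by rewrite leq_eqVlt => /predU1P[->//|il] lN; apply/ltW/partition_lt.
Qed.

Lemma partition_itv i : (i <= N)%N -> `[0, T]%classic (t i).
Proof.
have [t0 tN _] := tP; move=> iN; rewrite /= in_itv/= -{1}t0 -tN.
by rewrite !partition_le.
Qed.

Lemma step_size_le i : (i < N)%N -> t i.+1 - t i <= step_size N t.
Proof.
by move=> iN; rewrite /step_size (le_bigmax _ (fun i : 'I_N => t i.+1 - t i) (Ordinal iN)).
Qed.

Lemma find_node s i : (i <= N)%N -> s <= t i -> (forall l, (l < i)%N -> t l < s) ->
  find (fun l => s <= t l) (iota 0 N.+1) = i.
Proof.
move=> iN si li; apply/eqP; rewrite eqn_leq; apply/andP; split.
  rewrite leqNgt; apply/negP => /(before_find 0%N).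
  by rewrite nth_iota ?ltnS// add0n si.
rewrite leqNgt; apply/negP => fi.
have hasP : has (fun l => s <= t l) (iota 0 N.+1).
  by rewrite has_find size_iota (ltn_trans fi).
have := nth_find 0%N hasP; rewrite nth_iota; last by rewrite (ltn_trans fi).
by rewrite add0n leNgt li.
Qed.

Lemma find_node_exists s : 0 <= s -> s <= T -> exists i, [/\ (i <= N)%N, s <= t i &
  forall l, (l < i)%N -> t l < s].
Proof.
move=> s0 sT; have [_ tN _] := tP.
have ex : exists i, s <= t i by exists N; rewrite tN.
exists (ex_minn ex); case: ex_minnP => m sm mP; split => //.
  by apply: mP; rewrite tN.
by move=> l lm; rewrite ltNge; apply: contraL lm => /mP; rewrite -leqNgt.
Qed.

End partitions.

Section minimizing_movements.
Context {R : realType} {d : nat}.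
Local Notation V := 'rV[R]_d.+1.
Local Notation muV := (@leb R d).
Local Notation mu1 := (@completed_lebesgue_measure R).
Local Notation timeT := (caratheodory_type (mu_ext (wlength (R := R) idfun))).
Variables (Omega : set V) (T a : R) (k : nat) (f df : R -> V -> R).
Hypothesis mOmega : measurable (Omega : set (lebT R d)).
Hypothesis Omega_bounded : bounded_set Omega.
Hypothesis T0 : 0 < T.
Hypothesis fW : W11 Omega T f df.
Hypothesis fC : CL1 Omega T f.
Local Notation I0T := (`]0%R, T[%classic : set timeT).

Let Omega_fin : (muV Omega < +oo)%E := bounded_leb_lty Omega_bounded.

Section discrete.
Variables (N : nat) (t : nat -> R) (Z0 : set V) (Zd : nat -> set V).
Hypothesis tP : is_partition T N t.
Hypothesis dP : discrete_solution Omega a k f N t Z0 Zd.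

Lemma discrete_Xsets i : (i <= N)%N -> Xsets Omega (Zd i).
Proof. by case: dP => X0 _ XS; case: i => // i /XS[]. Qed.

(** The previous set is a competitor with zero dissipation, hence of finite total cost. A finite
    cost for the minimiser forces the inclusion, and the comparison is then the estimate. *)
Lemma discrete_step i : (i < N)%N -> ae_subset (Zd i.+1) (Zd i) /\
  renergy Omega k f (t i.+1) (Zd i.+1) +
    a * (fine (muV (Zd i)) - fine (muV (Zd i.+1))) <=
  renergy Omega k f (t i.+1) (Zd i).
Proof.
move=> iN; have [_ _ /(_ _ iN)[_ Smin]] := dP.
have X1 := discrete_Xsets iN; have X0 := discrete_Xsets (ltnW iN).
have tI := partition_itv tP iN.
have := Smin _ X0; rewrite !(energyE k mOmega fC tI)//.
have id0 : dissipation a (Zd i) (Zd i) = 0%E.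
  rewrite (dissipationE a mOmega Omega_fin X0.1 X0.1).
    by rewrite /excess setDv measure0 mulr0.
  by apply: aeW.
rewrite id0 adde0 => le1.
have sub : ae_subset (Zd i.+1) (Zd i).
  apply: contrapT => nsub; move: le1.
  by rewrite /dissipation; case: asboolP => // _; rewrite addey.
split => //; move: le1; rewrite (dissipationE a mOmega Omega_fin X0.1 X1.1 sub).
by rewrite lee_fin (excess_subset mOmega Omega_fin X0.1 X1.1 sub).
Qed.

Lemma discrete_subset i l : (i <= l)%N -> (l <= N)%N -> ae_subset (Zd l) (Zd i).
Proof.
elim: l => [|l ih]; first by rewrite leqn0 => /eqP -> _; exact: aeW.
rewrite leq_eqVlt => /predU1P[-> _|il lN]; first exact: aeW.
apply: (ae_subset_trans (discrete_step lN).1); apply: ih => //; exact: ltnW.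
Qed.

(** Between two nodes the energy of the old set changes only by its work increment, so the one-step
    estimates telescope. *)
Lemma discrete_upper_bound n : (n <= N)%N ->
  renergy Omega k f (t n) (Zd n) <= renergy Omega k f 0 (Zd 0%N) -
    a * (fine (muV (Zd 0%N)) - fine (muV (Zd n))) +
    k%:R * \sum_(i < n) (work Omega f (t i.+1) (Zd i) - work Omega f (t i) (Zd i)).
Proof.
have [t0 _ _] := tP; elim: n => [_|n ih nN].
  by rewrite big_ord0 t0 subrr !mulr0 subr0 addr0.
have := ih (ltnW nN); have [_] := discrete_step nN; rewrite big_ord_recr/=.
move: (\sum_(i < n) _) => S; rewrite {2 3}/renergy.
move: (renergy _ _ _ _ _) (renergy _ _ _ _ _) => e1 e0.
move: (work _ _ _ _) (work _ _ _ _) (rperimeter _ _) => w1 w0 p.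
by move: (fine _) (fine _) (fine _) => m1 m2 m3; lra.
Qed.

Lemma left_interpolant_node s i : (i <= N)%N -> s <= t i ->
  (forall l, (l < i)%N -> t l < s) -> left_interpolant N t Zd s = Zd i.
Proof. by move=> iN si li; rewrite /left_interpolant (find_node iN si li). Qed.

Lemma left_interpolant_exists s : `[0, T]%classic s ->
  exists i, [/\ (i <= N)%N, s <= t i, forall l, (l < i)%N -> t l < s &
    left_interpolant N t Zd s = Zd i].
Proof.
rewrite /= in_itv/= => /andP[s0 sT].
have [i [iN si li]] := find_node_exists tP s0 sT.
by exists i; split => //; exact: left_interpolant_node.
Qed.

Lemma left_interpolant_Xsets s : `[0, T]%classic s ->
  Xsets Omega (left_interpolant N t Zd s).
Proof. by move=> /left_interpolant_exists[i [iN _ _ ->]]; exact: discrete_Xsets. Qed.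

Lemma left_interpolant_subset s s' : 0 <= s -> s <= s' -> s' <= T ->
  ae_subset (left_interpolant N t Zd s') (left_interpolant N t Zd s).
Proof.
move=> s0 ss' s'T.
have sI : `[0, T]%classic s by rewrite /= in_itv/= s0 (le_trans ss').
have s'I : `[0, T]%classic s' by rewrite /= in_itv/= s'T (le_trans s0).
have [i [iN si li ->]] := left_interpolant_exists sI.
have [l [lN sl ll ->]] := left_interpolant_exists s'I.
apply: discrete_subset => //; rewrite leqNgt; apply/negP => /li.
by rewrite ltNge (le_trans ss').
Qed.

End discrete.

Variables (Z0 : set V) (Z : R -> set V).
Variables (tau : nat -> R) (N : nat -> nat) (t : nat -> nat -> R)
  (Zd : nat -> nat -> set V).
Hypothesis ZX : curve_in_X Omega T Z.
Hypothesis Z0E : ae_eq_set (Z 0) Z0.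
Hypothesis tau0 : tau j @[j --> \oo] --> (0 : R).
Hypothesis tP : forall j, is_partition T (N j) (t j) /\ step_size (N j) (t j) = tau j.
Hypothesis dP : forall j, discrete_solution Omega a k f (N j) (t j) Z0 (Zd j).
Hypothesis Zcvg : forall s : R, `[0, T]%classic s ->
  BV_weak_star_cvg Omega (fun j => \1_(left_interpolant (N j) (t j) (Zd j) s)) \1_(Z s).

Local Notation Zbar j s := (left_interpolant (N j) (t j) (Zd j) s).

Let ZZ t (tI : `[0, T]%classic t) : Zsets Omega (Z t) := (ZX tI).1.

Let ZbarZ j s (sI : `[0, T]%classic s) : Zsets Omega (Zbar j s) :=
  (left_interpolant_Xsets (tP j).1 (dP j) sI).1.

Lemma interpolant_set_cvg s : `[0, T]%classic s -> set_cvg (fun j => Zbar j s) (Z s).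
Proof.
move=> sI; apply: (BV_cvg_set_cvg mOmega _ (ZZ sI) (Zcvg sI)) => j.
exact: ZbarZ.
Qed.

Lemma GMM_subset s s' : 0 <= s -> s <= s' -> s' <= T -> ae_subset (Z s') (Z s).
Proof.
move=> s0 ss' s'T.
have sI : `[0, T]%classic s by rewrite /= in_itv/= s0 (le_trans ss').
have s'I : `[0, T]%classic s' by rewrite /= in_itv/= s'T (le_trans s0).
apply: (set_cvg_ae_subset (fun j => ZbarZ j s'I) (ZZ s'I) (fun j => ZbarZ j sI) (ZZ sI)
  (interpolant_set_cvg s'I) (interpolant_set_cvg sI)) => j.
exact: (left_interpolant_subset (tP j).1 (dP j)).
Qed.

Lemma GMM_upper_bound :
  renergy Omega k f T (Z T) <= renergy Omega k f 0 (Z 0) -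
    a * (fine (muV (Z 0)) - fine (muV (Z T))) +
    k%:R * \int[mu1]_(r in I0T) (\1_(`]0, T]) r * power Omega df r (Z r)).
Proof.
have T0' := ltW T0.
have I0 : `[0, T]%classic (0 : R) by rewrite /= in_itv/= lexx.
have IT : `[0, T]%classic T by rewrite /= in_itv/= lexx andbT.
have [_ cH] : mu1.-integrable I0T (EFin \o (fun r => \1_(`]0, T]) r * power Omega df r (Z r))) /\
  \sum_(i < N j) (work Omega f (t j i.+1) (Zd j i) - work Omega f (t j i) (Zd j i)) @[j --> \oo]
    --> \int[mu1]_(r in I0T) (\1_(`]0, T]) r * power Omega df r (Z r)).
  apply: (step_power_cvg mOmega fW fC (conj (lexx 0) (lexx T))).
  - by move=> r rI; have rI' : `[0, T]%classic r by [exact: subset_itv_oo_cc]; exact: (ZZ rI').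
  - by move=> j; have [[]] := tP j.
  - by move=> j; have [[]] := tP j.
  - by move=> j i iN; apply: (partition_le (tP j).1).
  - by move=> j i iN; exact: (discrete_Xsets (dP j) (ltnW iN)).1.
  apply: filterS (monotone_family_ae_continuous mOmega Omega_fin ZZ GMM_subset).
  move=> r rP rI e e0; have e20 : 0 < e / 2 by rewrite divr_gt0.
  have [q q0 [rq0 rqT Zq]] := rP rI _ e20.
  have rI' : `[0, T]%classic r by exact: subset_itv_oo_cc.
  have r0T := rI'; rewrite /= in_itv/= in r0T; case/andP: r0T => r0 rT.
  have qI1 : `[0, T]%classic (r - q) by rewrite /= in_itv/= rq0/= (le_trans _ rT)// gerBl ltW.
  have qI2 : `[0, T]%classic (r + q) by rewrite /= in_itv/= rqT andbT addr_ge0// ltW.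
  near=> j => i iN /andP[tir rti].
  have tauq : tau j < q.
    have : `|0 - tau j| < q by near: j; move/cvgrPdist_lt: tau0; exact.
    by rewrite sub0r normrN; exact: le_lt_trans (ler_norm _).
  have [c1 _] : (muV (Zbar j (r - q) `\` Z (r - q)) < (e / 2)%:E)%E /\
      (muV (Z (r - q) `\` Zbar j (r - q)) < (e / 2)%:E)%E.
    by near: j; exact: interpolant_set_cvg.
  have [_ c2] : (muV (Zbar j r `\` Z r) < e%:E)%E /\ (muV (Z r `\` Zbar j r) < e%:E)%E.
    by near: j; exact: interpolant_set_cvg.
  have [tPj tauj] := tP j.
  have mono_t l : (l < i.+1)%N -> t j l < r.
    by rewrite ltnS => li; apply: le_lt_trans tir; apply: (partition_le tPj) => //; exact: ltnW.
  have Zbar_r : Zbar j r = Zd j i.+1.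
    exact: (left_interpolant_node _ iN rti mono_t).
  have [l [lN ql ll Zbar_q]] := left_interpolant_exists (Zd j) tPj qI1.
  (* The step containing [r] is shorter than [q], so [r - q] lies before the node [t j i]. *)
  have li : (l <= i)%N.
    rewrite leqNgt; apply/negP => /ll; apply/negP; rewrite -leNgt.
    have := step_size_le (t j) iN; rewrite tauj; move: rti tauq => rti tauq.
    by move: (t j i.+1) (t j i) rti tir => x y *; lra.
  have ZZi := (discrete_Xsets (dP j) (ltnW iN)).1.
  have ZZi1 := (discrete_Xsets (dP j) iN).1.
  have ZZl := (discrete_Xsets (dP j) lN).1.
  split; last first.
    apply: le_lt_trans c2; rewrite Zbar_r.
    apply: (excess_ae_mono (ZZ rI') (ZZ rI') ZZi ZZi1); first exact: aeW.
    exact: (discrete_step tPj (dP j) iN).1.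
  rewrite Zbar_q in c1.
  apply: (@le_lt_trans _ _ (muV (Zd j l `\` Z (r + q)))).
    apply: (excess_ae_mono ZZi ZZl (ZZ rI') (ZZ qI2)).
      exact: (discrete_subset tPj (dP j) li (ltnW iN)).
    by apply: GMM_subset => //; rewrite lerDl ltW.
  (* One [e / 2] pays for the discrete approximation at [r - q], the other for the drop of [Z]
     across [r]. *)
  apply: (@le_lt_trans _ _ (muV (Zd j l `\` Z (r - q)) + muV (Z (r - q) `\` Z (r + q)))%E).
    by apply: measureD_triangle; [exact: ZZl.1|exact: (ZZ qI1).1|exact: (ZZ qI2).1].
  by rewrite [e]splitr EFinD; exact: lteD.
have XbarT j : Zbar j T = Zd j (N j).
  have [[t0 tN tS] _] := tP j.
  apply: left_interpolant_node => //; first by rewrite tN.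
  by move=> l lN; rewrite -[X in _ < X]tN; exact: (partition_lt (tP j).1).
have cT : set_cvg (fun j => Zd j (N j)) (Z T).
  by have := interpolant_set_cvg IT; under eq_fun do rewrite XbarT.
have XN j : Xsets Omega (Zd j (N j)) by exact: (discrete_Xsets (dP j) (leqnn _)).
have X0 j : Xsets Omega (Zd j 0%N) by exact: (discrete_Xsets (dP j) (leq0n _)).
have E0 j : ae_eq_set (Zd j 0%N) (Z 0).
  have [_ [h1 h2] _] := dP j; have [h3 h4] := Z0E.
  by split; [exact: (ae_subset_trans h1 h4)|exact: (ae_subset_trans h3 h2)].
have r0E j : renergy Omega k f 0 (Zd j 0%N) = renergy Omega k f 0 (Z 0).
  rewrite /renergy (ae_eq_per mOmega Omega_bounded (X0 j) (ZX I0) (E0 j)).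
  by rewrite /work (ae_eq_pairing mOmega (force_L1 fC I0) (X0 j).1 (ZZ I0) (E0 j)).
have m0E j : fine (muV (Zd j 0%N)) = fine (muV (Z 0)).
  exact: (ae_eq_measure mOmega Omega_bounded (X0 j).1 (ZZ I0) (E0 j)).
(* The terminal perimeter is left alone on one side for [per_lsc]; the work of the terminal set
   joins the other side, where every term converges. *)
rewrite {1}/renergy -lerBrDr.
apply: (per_lsc mOmega Omega_bounded XN (ZX IT) cT (X_ := fun j =>
  renergy Omega k f 0 (Z 0) - a * (fine (muV (Z 0)) - fine (muV (Zd j (N j)))) +
  k%:R * \sum_(i < N j) (work Omega f (t j i.+1) (Zd j i) - work Omega f (t j i) (Zd j i)) -
  k%:R * work Omega f T (Zd j (N j)))).
  move=> j; have := discrete_upper_bound (tP j).1 (dP j) (leqnn _).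
  rewrite r0E m0E; have [[_ -> _] _] := tP j.
  by rewrite {1}/renergy lerBrDr.
apply: cvgB; last first.
  apply: cvgM; first exact: cvg_cst.
  apply: (set_cvg_pairing mOmega (force_L1 fC IT) (fun j => (XN j).1) (ZZ IT) cT).
apply: cvgD; last by apply: cvgM => //; exact: cvg_cst.
apply: cvgB; first exact: cvg_cst.
apply: cvgM; first exact: cvg_cst.
apply: cvgB; first exact: cvg_cst.
exact: (set_cvg_measure mOmega Omega_bounded (fun j => (XN j).1) (ZZ IT) cT).
Unshelve. all: by end_near. Qed.

End minimizing_movements.

(** * Energy balance *)

(** Completeness makes [g] measurable whatever its values on the exceptional null set; this handles
    [dt_energy] at times where [df] is not in $L^1$. *)
Lemma ae_eq_integrable_integral d (E : measurableType d) (R : realType)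
    (mu : {measure set E -> \bar R}) (D : set E) (f g : E -> \bar R) :
  measure_is_complete mu -> measurable D -> ae_eq mu D f g ->
  mu.-integrable D f ->
  mu.-integrable D g /\ (\int[mu]_(x in D) g x = \int[mu]_(x in D) f x)%E.
Proof.
move=> cmu mD fg /integrableP[mf intf].
have mg := ae_measurable_fun cmu fg mf.
split; last by apply/esym; exact: ae_eq_integral.
apply/integrableP; split => //; apply: le_lt_trans intf.
rewrite le_eqVlt; apply/orP; left; apply/eqP/esym.
apply: ae_eq_integral => //; [exact: measurableT_comp..|].
exact: ae_eq_abse.
Qed.

Section energy_balance.
Context {R : realType} {d : nat}.
Local Notation V := 'rV[R]_d.+1.
Local Notation muV := (@leb R d).
Local Notation mu1 := (@completed_lebesgue_measure R).
Local Notation timeT := (caratheodory_type (mu_ext (wlength (R := R) idfun))).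
Variables (Omega : set V) (T : R) (k : nat) (f df : R -> V -> R).
Hypothesis mOmega : measurable (Omega : set (lebT R d)).
Hypothesis fW : W11 Omega T f df.
Local Notation I0T := (`]0%R, T[%classic : set timeT).

Lemma ae_neq (x : R) : {ae mu1, forall r : timeT, r <> x :> R}.
Proof.
exists [set x]; split; last by move=> r /= /contrapT.
- by rewrite -set_itv1; exact: itv_time_measurable.
- exact: time_measure1.
Qed.

(** Extended by zero, the two integrands agree away from 0, [T] and the null set of times where
    [df r] is not in $L^1$; elsewhere on the interval [dt_energy] is [k] times the power. *)
Lemma dt_energy_integral (Z : R -> set V) (t : R) :
  (forall r, `[0, T]%classic r -> Zsets Omega (Z r)) -> 0 <= t -> t <= T ->
  mu1.-integrable I0T (fun r => (\1_(`]0, t]) r * power Omega df r (Z r))%:E) ->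
  mu1.-integrable `[0%R, t] (fun s => dt_energy Omega k df s (Z s)) /\
  (\int[mu1]_(s in `[0%R, t]) dt_energy Omega k df s (Z s) =
   (k%:R * \int[mu1]_(r in I0T) (\1_(`]0, t]) r * power Omega df r (Z r)))%:E)%E.
Proof.
move=> ZZ t0 tT iP.
have mI : measurable I0T by exact: itv_time_measurable.
have mJ : measurable (`[0%R, t]%classic : set timeT) by exact: itv_time_measurable.
pose G r : \bar R := (k%:R * (\1_(`]0, t]) r * power Omega df r (Z r)))%:E.
pose g r := dt_energy Omega k df r (Z r).
have iG : mu1.-integrable I0T G by exact: (integrableZl mI k%:R iP).
have aeE : ae_eq mu1 setT (G \_ I0T) (g \_ `[0, t]).
  apply: filterS3 (ae_neq 0) (ae_neq T) (rate_ae_L1 fW) => r r0 rT rL1 _.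
  rewrite !patchE; case: ifPn => [/set_mem rI|rI].
    have rI' : `[0, T]%classic r by exact: subset_itv_oo_cc.
    case: ifPn => [|]; rewrite ?inE ?notin_setE /= in_itv/= => rt.
      rewrite /g /dt_energy force_pairing//; [|exact: rL1|exact: ZZ].
      rewrite /G indicE mem_set ?mul1r//= in_itv/=; case/andP: rt => rt0 ->.
      by rewrite andbT lt_neqAle rt0 andbT; apply/eqP => /esym.
    rewrite /G indicE memNset ?mul0r ?mulr0//= in_itv/=.
    by apply: contra_not rt => /andP[/ltW -> ->].
  case: ifPn => // /set_mem /= rt; exfalso; move/negP: rI; apply; apply/mem_set.
  rewrite /= in_itv/=; move: rt; rewrite in_itv/= => /andP[h1 h2].
  rewrite !lt_neqAle h1 (le_trans h2 tT) !andbT.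
  by apply/andP; split; apply/eqP => // /esym.
have := (@ae_eq_integrable_integral _ _ _ mu1 setT _ _
  completed_lebesgue_measure_is_complete measurableT aeE).
case; first exact/(integrable_mkcond _ mI).1.
rewrite -(integrable_mkcond _ mJ) -!integral_mkcond => ig gE; split => //.
rewrite gE /G EFinM /Rintegral fineK; last exact: (integrable_fin_num mI iP).
by under eq_integral do rewrite EFinM; exact: integralZl.
Qed.

End energy_balance.

Theorem theorem4p5 (R : realType) (d : nat) (Omega : set 'rV[R]_d.+1)
    (T a : R) (k : nat) (F : R -> set 'rV[R]_d.+1)
    (f df : R -> 'rV[R]_d.+1 -> R) (Z0 : set 'rV[R]_d.+1) :
  bounded_lipschitz_domain Omega -> 0 < T -> 0 < a ->
  loading Omega T F f df ->
  Xsets Omega Z0 ->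
  (forall Z', Xsets Omega Z' ->
    (energy Omega k f 0 Z0 <=
     energy Omega k f 0 Z' + dissipation a Z0 Z')%E) ->
  forall Z : R -> set 'rV[R]_d.+1,
  SMM Omega T a k f Z0 Z ->
  energetic_solution Omega T a k f df Z.
Proof.
move=> [oO _ _ bO _] T0 a0 [_ _ fW fC _] _ _ Z [[ZX Z0E] gmm Zst].
case: gmm => tau [N [t [Zd [[_ _ tau0] tP dP _ Zcvg]]]].
have mO := open_leb_measurable oO.
have Ofin := bounded_leb_lty bO.
have Znd := GMM_subset mO bO fC ZX tP dP Zcvg.
have ZZ r (rI : `[0, T]%classic r) : Zsets Omega (Z r) := (ZX r rI).1.
have upper := GMM_upper_bound mO bO T0 fW fC ZX Z0E tau0 tP dP Zcvg.
have lower := stable_lower_bound mO Ofin fW fC ZX Znd Zst.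
split => // r rI; have r0T := rI; rewrite /= in_itv/= in r0T; case/andP: r0T => r0 rT.
have [i1 l1] := lower _ _ (lexx 0) r0 rT.
have [i2 l2] := lower _ _ r0 rT (lexx T).
have [idt ->] := dt_energy_integral k mO fW ZZ r0 rT i1.
split => //.
have I0 : `[0, T]%classic (0 : R) by rewrite /= in_itv/= lexx ltW.
rewrite (energyE k mO fC rI (ZX _ rI)) (energyE k mO fC I0 (ZX _ I0)).
rewrite (dissipationE a mO Ofin (ZZ _ I0) (ZZ _ rI) (Znd _ _ (lexx 0) r0 rT)).
rewrite (excess_subset mO Ofin (ZZ _ I0) (ZZ _ rI) (Znd _ _ (lexx 0) r0 rT)).
rewrite -!EFinD; congr EFin.
have mI := itv_time_measurable `]0%R, T[.
(* Half-open intervals meet at [r] without overlap, so the indicators add up at every time. *)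
have split_int :
  \int[completed_lebesgue_measure]_(s in `]0%R, T[) (\1_(`]0, T]) s * power Omega df s (Z s)) =
  \int[completed_lebesgue_measure]_(s in `]0%R, T[) (\1_(`]0, r]) s * power Omega df s (Z s)) +
  \int[completed_lebesgue_measure]_(s in `]0%R, T[) (\1_(`]r, T]) s * power Omega df s (Z s)).
  rewrite -RintegralD//; apply: eq_Rintegral => s /set_mem /=.
  rewrite in_itv/= => /andP[s0 sT]; rewrite -mulrDl; congr (_ * _).
  rewrite !indicE mem_set; last by rewrite /= in_itv/= s0 ltW.
  have [sr|rs] := leP s r.
    rewrite mem_set; last by rewrite /= in_itv/= s0.
    by rewrite memNset ?addr0//= in_itv/= ltNge sr.
  rewrite memNset; last by rewrite /= in_itv/= (leNgt s) rs andbF.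
  by rewrite mem_set ?add0r//= in_itv/= rs ltW.
rewrite split_int in upper.
move: upper l1 l2; move: (Rintegral _ _ _) (Rintegral _ _ _) => A B.
move: (renergy _ _ _ _ _) (renergy _ _ _ _ _) (renergy _ _ _ _ _) => e1 e2 e3.
move: (fine _) (fine _) (fine _) => m1 m2 m3; clear => h1 h2 h3.
by apply/eqP; rewrite eq_le; apply/andP; split; lra.
Qed.
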